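(* Let $a, d_1,\dots,d_k,\overline{d}_1,\dots,\overline{d}_t,d'_1,\dots,d'_l$ be positive integers for which the quasi-octagon $\mathcal{O}:=\mathcal{O}_{a}(d_1,\dots,d_k;\ \overline{d}_1,\dots,\overline{d}_t;\ d'_1,\dots,d'_l)$ has upper, middle and lower heights $h_1,h_2,h_3$, respectively, and has both upper and lower widths equal to $w$, with $w>h_1,h_2,h_3$. (a) If $h_1+h_3\neq w+h_2$, then $\mathcal{O}$ has no tilings. (b) If $h_1+h_3=w+h_2$, then the number of tilings of $\mathcal{O}$ is equal to $$2^{\mathcal{C}_1+\mathcal{C}_2+\mathcal{C}_3-h_1(2w-h_1+1)/2-h_2(2w-h_2+1)/2-h_3(2w-h_3+1)/2}$$ $$\times\, 2^{\binom{h_1+2h_2+h_3}{2}-2h_2(w+h_2)-\binom{h_1+h_2}{2}-\binom{h_2+h_3}{2}}$$ $$\times\,\frac{\prod_{i=h_2+h_3+1}^{h_2+w}(i-1)!\ \prod_{i=h_1+h_2+1}^{h_2+w}(i-1)!\ \prod_{i=1}^{w-h_3}(i-1)!\ \prod_{i=1}^{w-h_1}(i-1)!}{\prod_{i=1}^{w-h_2}(h_2+i-1)!\,(w-i)!},$$ where $\mathcal{C}_1$ is the number of black regular cells in the upper part, $\mathcal{C}_2$ is the number of white regular cells in the middle part, and $\mathcal{C}_3$ is the number of black regular cells in the lower part of the region.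
   Context: **Diagonals.** Work on the square lattice $\mathbb{Z}^2$ (unit squares). A lattice diagonal is a line $y=x+c$ with $c\in\mathbb{Z}$ (southwest-to-northeast); distances between diagonals are measured in units of $\sqrt2/2$, so $y=x+c$ and $y=x+c'$ are at distance $|c-c'|$; a diagonal is ''above'' another if its $c$ is larger. Given positive integers $d_1,\dots,d_k$, $\overline d_1,\dots,\overline d_t$, $d'_1,\dots,d'_l$ ($k,t,l\ge 1$), draw in: two distinguished diagonals $\ell$ and $\ell'$, with $\ell'$ below $\ell$; $k$ diagonals above $\ell$ such that the successive distances, starting from the top one and ending at $\ell$, are $d_1,\dots,d_k$; $l$ diagonals below $\ell'$ such that the successive distances, starting from the bottom one and ending at $\ell'$, are $d'_1,\dots,d'_l$; and $t-1$ diagonals between $\ell$ and $\ell'$ such that the successive distances from $\ell$ down to $\ell'$ are $\overline d_1,\dots,\overline d_t$. The drawn-in diagonals cut the unit squares they pass through into two triangles; the resulting pieces (unit squares and triangles) are the fundamental regions. Color them black and white so that any two sharing an edge have opposite colors, and so that the triangles pointing toward $\ell$ with bases on the top drawn-in diagonal are white. **Quasi-octagon.** Let $A$ be a lattice point on the top diagonal. Draw a lattice path from $A$ with unit steps south or east such that at each step the black fundamental region is on the right, until it meets $\ell$ at a lattice point $B$; continue from $B$ in the same fashion, but with the black fundamental region on the left at each step, until a lattice point $C\in\ell'$; continue from $C$, with the black fundamental region on the right at each step, until a lattice point $D$ on the bottom diagonal. This path is the northeastern boundary. Let $H$ be the lattice point on the top diagonal to the left of $A$ with $|AH|=a\sqrt2$.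 The southwestern boundary, from $H$ through $G\in\ell$ and $F\in\ell'$ to $E$ on the bottom diagonal, is the reflection of the northeastern boundary in the perpendicular bisector of $AH$. The segments $AH$ and $DE$ complete the boundary (the two boundary paths are assumed not to meet). The enclosed region is the quasi-octagon $\mathcal{O}_a(d_1,\dots,d_k;\overline d_1,\dots,\overline d_t;d'_1,\dots,d'_l)$. Standing assumption: the triangular fundamental regions inside the region running along the bottom diagonal are white (equivalently, the last step of the southwestern boundary is an east step). **Cells, heights, widths.** The fundamental regions inside the quasi-octagon are its cells. A cell is regular if it is a square cell or a triangular cell pointing away from $\ell'$. A row of cells consists of all triangular cells of a given color with bases resting on a fixed lattice diagonal, or of all square cells of a given color passed through by a fixed lattice diagonal. The upper, middle and lower parts are the portions of the region above $\ell$, between $\ell$ and $\ell'$, and below $\ell'$. The upper height $h_1$ and lower height $h_3$ are the numbers of rows of black regular cells in the upper and lower parts; the middle height $h_2$ is the number of rows of white regular cells in the middle part. The upper width is $|BG|/\sqrt2$ and the lower width is $|CF|/\sqrt2$ (Euclidean lengths). **Tilings.** A tile is the union of two fundamental regions sharing an edge. A tiling of a region is a covering of the region by tiles with no gaps or overlaps. *)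

(* Defs.v *)
From HB Require Import structures.
From mathcomp Require Import all_boot all_order all_algebra.
From mathcomp Require Import zify.

Set Implicit Arguments.
Unset Strict Implicit.
Unset Printing Implicit Defensive.

Import Order.TTheory GRing.Theory Num.Theory.
Local Open Scope ring_scope.

(* A point (x, y) of Z^2 also names the unit square [x, x+1] x [y, y+1]. *)
Definition point : Type := (int * int)%type.

(* The point (x, y) lies on the lattice diagonal y = x + level (x, y), and that
   diagonal is also the one passing through the unit square named (x, y). *)
Definition level (p : point) : int := p.2 - p.1.

(* A whole unit square, or one of the two triangles into which its southwest-
   northeast diagonal cuts it: UpTri is the northwestern half (it points up,
   away from all lower diagonals), DownTri the southeastern half. *)
Inductive piece : Type := Full | UpTri | DownTri.

Definition piece_code (k : piece) : option bool :=
  match k with Full => None | UpTri => Some true | DownTri => Some false end.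
Definition piece_decode (b : option bool) : piece :=
  match b with None => Full | Some true => UpTri | Some false => DownTri end.
Lemma piece_codeK : cancel piece_code piece_decode.
Proof. by case. Qed.
HB.instance Definition _ := Countable.copy piece (can_type piece_codeK).

Definition cell : Type := (piece * point)%type.

Definition diag (u : cell) : int := level u.2.

(* Unit edges and square diagonals, each as the pair of its endpoints, the one
   with smaller coordinates first. *)
Definition edges (u : cell) : seq (point * point) :=
  let: (k, (x, y)) := u in
  let bottom := ((x, y), (x + 1, y)) in
  let top := ((x, y + 1), (x + 1, y + 1)) in
  let left := ((x, y), (x, y + 1)) in
  let right := ((x + 1, y), (x + 1, y + 1)) in
  let hypotenuse := ((x, y), (x + 1, y + 1)) in
  match k with
  | Full => [:: bottom; top; left; right]
  | UpTri => [:: left; top; hypotenuse]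
  | DownTri => [:: bottom; right; hypotenuse]
  end.

Definition adjacent (u v : cell) : bool :=
  (u != v) && has (fun e => e \in edges v) (edges u).

(* The side of the diagonal y = x + c on which the interior of u lies, for u a
   square not cut by that diagonal or a triangle. *)
Definition above (c : int) (u : cell) : bool :=
  if u.1 is UpTri then c <= diag u else c < diag u.
Definition below (c : int) (u : cell) : bool :=
  if u.1 is DownTri then diag u <= c else diag u < c.

(* The diagonal l is y = x + ell; the point A has abscissa abscA. *)
Record quasi_octagon : Type := QuasiOctagon {
  side_a : nat;
  upper_dist : seq nat;
  middle_dist : seq nat;
  lower_dist : seq nat;
  ell : int;
  abscA : int }.

Section QuasiOctagon.
Variable O : quasi_octagon.

Definition nupper : nat := sumn (upper_dist O).
Definition nmiddle : nat := sumn (middle_dist O).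
Definition nlower : nat := sumn (lower_dist O).
Definition nsteps : nat := (nupper + nmiddle + nlower)%N.

Definition ell' : int := ell O - nmiddle%:Z.
Definition top_diag : int := ell O + nupper%:Z.
Definition bottom_diag : int := ell' - nlower%:Z.

Definition drawn_diags : seq int :=
  [seq ell O + (sumn (drop i (upper_dist O)))%:Z
     | i <- iota 0 (size (upper_dist O))]
  ++ [seq ell O - (sumn (take i (middle_dist O)))%:Z
     | i <- iota 0 (size (middle_dist O)).+1]
  ++ [seq ell' - (sumn (drop i (lower_dist O)))%:Z
     | i <- iota 0 (size (lower_dist O))].

Definition drawn (c : int) : bool := c \in drawn_diags.

Definition fundamental (u : cell) : bool := (u.1 != Full) == drawn (diag u).

Definition is_coloring (black : cell -> bool) : Prop :=
  (forall u v : cell, fundamental u -> fundamental v -> adjacent u v ->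
     black u != black v)
  /\ (forall s : point, level s = top_diag -> ~~ black (DownTri, s)).

(* The fundamental region containing the northwestern (left and top), resp. the
   southeastern (bottom and right), edges of the unit square s. *)
Definition nw_cell (s : point) : cell :=
  (if drawn (level s) then UpTri else Full, s).
Definition se_cell (s : point) : cell :=
  (if drawn (level s) then DownTri else Full, s).

Inductive step : Type := South | East.

Definition move (p : point) (m : step) : point :=
  match m with South => (p.1, p.2 - 1) | East => (p.1 + 1, p.2) end.

Definition right_cell (p : point) (m : step) : cell :=
  match m with
  | South => se_cell (p.1 - 1, p.2 - 1)
  | East => nw_cell (p.1, p.2 - 1)
  end.
Definition left_cell (p : point) (m : step) : cell :=
  match m with
  | South => nw_cell (p.1, p.2 - 1)
  | East => se_cell p
  end.

(* The region required to be black when stepping from p: on the left from B (on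
   l) until C (on l'), on the right before B and from C onwards. *)
Definition path_cell (p : point) (m : step) : cell :=
  if (ell' < level p) && (level p <= ell O) then left_cell p m
  else right_cell p m.

Section Coloring.
Variable black : cell -> bool.

(* South and East have oppositely coloured path cells, so exactly one of the two
   steps is allowed; see black_path_step. *)
Definition path_step (p : point) : step :=
  if black (path_cell p South) then South else East.

(* Each step goes down one diagonal, so ne_point n is the vertex of the
   northeastern boundary on y = x + (top_diag - n); in particular B, C and D are
   its values at nupper, nupper + nmiddle and nsteps. *)
Fixpoint ne_point (n : nat) : point :=
  if n is m.+1 then move (ne_point m) (path_step (ne_point m))
  else (abscA O, abscA O + top_diag).

(* The perpendicular bisector of AH, where H = A - (a, a), is x + y = s with
   s = x_A + y_A - a; reflection in it sends (x, y) to (s - y, s - x). *)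
Definition reflect (p : point) : point :=
  let s := abscA O + (abscA O + top_diag) - (side_a O)%:Z in
  (s - p.2, s - p.1).

Definition sw_point (n : nat) : point := reflect (ne_point n).

Definition boundaries_disjoint : Prop :=
  forall m n : nat, (m <= nsteps)%N -> (n <= nsteps)%N ->
    ne_point m != sw_point n.

(* Both boundaries are monotone across the diagonals, so the enclosed region
   meets y = x + (top_diag - n) in the segment from sw_point n to ne_point n.
   A square (resp. triangle) has its diagonal (resp. hypotenuse) on a lattice
   diagonal, and is enclosed iff it lies between the top and bottom diagonals
   and that diagonal (resp. hypotenuse) lies in the corresponding segment. *)
Definition cells_at (n : nat) : seq cell :=
  let: (x, y) := sw_point n in
  let width := `|(ne_point n).1 - x|%N in
  [seq u <- [seq (k, (x + i%:Z, y + i%:Z)) | k <- [:: Full; UpTri; DownTri],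
                                            i <- iota 0 width]
     | [&& fundamental u, below top_diag u & above bottom_diag u]].

Definition region : seq cell := flatten [seq cells_at n | n <- iota 0 nsteps.+1].

Definition region_cell : finType := seq_sub region.

Definition bottom_white : Prop :=
  forall u : cell, u \in region -> diag u = bottom_diag -> ~~ black u.

Definition in_upper (u : cell) : bool := above (ell O) u.
Definition in_middle (u : cell) : bool := below (ell O) u && above ell' u.
Definition in_lower (u : cell) : bool := below ell' u.

Definition regular (u : cell) : bool :=
  match u.1 with
  | Full => true
  | UpTri => above ell' u
  | DownTri => below ell' u
  end.

(* Two cells are in the same row iff they agree on this label. *)
Definition row_label (u : cell) : bool * bool * int :=
  (u.1 == Full, black u, diag u).

Definition num_rows (P : pred cell) : nat :=
  size (undup [seq row_label u | u <- region & P u]).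
Definition num_cells (P : pred cell) : nat :=
  #|[set u : region_cell | P (val u)]|.

Definition upper_black_regular : pred cell :=
  fun u => [&& in_upper u, regular u & black u].
Definition middle_white_regular : pred cell :=
  fun u => [&& in_middle u, regular u & ~~ black u].
Definition lower_black_regular : pred cell :=
  fun u => [&& in_lower u, regular u & black u].

Definition upper_height : nat := num_rows upper_black_regular.
Definition middle_height : nat := num_rows middle_white_regular.
Definition lower_height : nat := num_rows lower_black_regular.

(* The Euclidean distance of two points of a lattice diagonal is sqrt 2 times
   the difference of their abscissae. *)
Definition upper_width : nat :=
  `|(ne_point nupper).1 - (sw_point nupper).1|%N.
Definition lower_width : nat :=
  `|(ne_point (nupper + nmiddle)).1 - (sw_point (nupper + nmiddle)).1|%N.

Definition is_tile (t : {set region_cell}) : bool :=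
  [exists u : region_cell, exists v : region_cell,
     (t == [set u; v]) && adjacent (val u) (val v)].

Definition tilings : {set {set {set region_cell}}} :=
  [set P : {set {set region_cell}} |
     partition P [set: region_cell] && [forall t in P, is_tile t]].

End Coloring.

Lemma fundamental_nw s : fundamental (nw_cell s).
Proof. by rewrite /fundamental /nw_cell /diag /=; case: (drawn _). Qed.

Lemma fundamental_se s : fundamental (se_cell s).
Proof. by rewrite /fundamental /se_cell /diag /=; case: (drawn _). Qed.

Lemma black_path_step (black : cell -> bool) (p : point) (m : step) :
  is_coloring black -> black (path_cell p m) <-> m = path_step black p.
Proof.
case: p => x y [col _].
suff opp : black (path_cell (x, y) South) != black (path_cell (x, y) East).
  rewrite /path_step; case: m; move: opp;
  by case: (black (path_cell _ South)); case: (black (path_cell _ East)).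
rewrite /path_cell; case: ifP => _ /=; apply: col;
  rewrite ?fundamental_nw ?fundamental_se //.
- apply/andP; split.
    by apply/eqP => -[_] ?; lia.
  rewrite /nw_cell /se_cell /=; apply/hasP; exists ((x, y), (x + 1, y)).
    by case: ifP => _; rewrite subrK !inE eqxx ?orbT.
  by case: ifP => _; rewrite !inE eqxx ?orbT.
- apply/andP; split.
    by apply/eqP => -[_] ?; lia.
  rewrite /nw_cell /se_cell /=; apply/hasP; exists ((x, y - 1), (x, y)).
    by case: ifP => _; rewrite !subrK !inE eqxx ?orbT.
  by case: ifP => _; rewrite subrK !inE eqxx ?orbT.
Qed.

(* The required colouring exists. *)
Lemma coloring_exists : exists black, is_coloring black.
Proof.
pose nw c := odd `|c|%N (+) odd (count (fun e : int => (c < e)%R) (undup drawn_diags)).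
have nwS c : nw (c - 1) = ~~ (nw c (+) drawn c).
  have -> : drawn c = odd (count_mem c (undup drawn_diags)).
    by rewrite (count_uniq_mem _ (undup_uniq _)) mem_undup oddb.
  rewrite /nw.
  have -> : count (fun e : int => (c - 1 < e)%R) (undup drawn_diags) =
    (count (fun e : int => (c < e)%R) (undup drawn_diags) + count_mem c (undup drawn_diags))%N.
    rewrite -count_predUI [X in (_ + X)%N](_ : _ = 0)%N ?addn0.
      by apply: eq_count => e /=; lia.
    by rewrite -(count_pred0 (undup drawn_diags)); apply: eq_count => e /=; lia.
  rewrite oddD.
  have -> : odd `|c - 1|%N = ~~ odd `|c|%N by lia.
  by rewrite !addNb addbA.
pose col (u : cell) := nw (diag u) (+) (u.1 == DownTri).
exists (fun u => col u (+) col (DownTri, (0, top_diag))); split; last first.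
  by move=> s E; rewrite /col /diag /= E /level /= subr0 addbb.
move=> [k [x y]] [k' [x' y']] fu fv uv.
suff: col (k, (x, y)) != col (k', (x', y')).
  by case: (col (k, _)); case: (col (k', _)); case: (col _).
have nwS' z c : z = c - 1 -> nw z = ~~ (nw c (+) drawn c) by move=> ->.
case/andP: uv => ne /hasP[[[p q] [r s]]]; move: ne fu fv.
rewrite /fundamental /col /diag /level /= !xpair_eqE.
case: k; case: k' => /= ne; rewrite ?addbF ?addbT => /eqP fu /eqP fv;
  rewrite !inE !xpair_eqE => eu ev.
all: have [lu|[lu|[eqx eqy]]] : y - x = (y' - x') - 1 \/ y' - x' = (y - x) - 1
  \/ x = x' /\ y = y' by lia.
all: try by exfalso; clear -ne eu ev lu; lia.
all: try by rewrite (nwS' _ _ lu) -?fu -?fv ?addbF ?addbT; case: (nw _).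
all: move: fu fv ne; rewrite -eqx -eqy ?eqxx // => fu fv _.
all: by [rewrite -fv in fu | case: (nw _)].
Qed.

End QuasiOctagon.

(* Main.v *)
Require Import Defs.
From HB Require Import structures.
From mathcomp Require Import all_boot all_order all_algebra.
From mathcomp Require Import zify ring.

(* Cut the region along the lattice diagonals.  Between two consecutive diagonals
   a row of n + 1 cells and a row of n cells form a zigzag path, and a perfect
   matching of part of such a path is unique when it exists, so a tiling is a
   sequence of subsets, one per diagonal.  Record at each diagonal the "particles":
   the black cells matched downwards or the white cells matched upwards.  Going
   from black to white a particle moves by 0 or 1; going from white to black the
   particles interlace, and exchanging particles and holes exchanges the two rules.
   The resulting transfer operators B and W satisfy B W = 2 W B (the spider move).

   Starting from the empty configuration, W^k counts Gelfand-Tsetlin patterns, which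
   B multiplies by 2^k.  So, up to powers of 2, the upper and the lower part
   contribute patterns with h1 particles and with h3 holes, and the operators of the
   middle part commute to h2 interlacings followed by h2 moves.  Such interlacings
   prepend and append true bits to a configuration s, whence the tilings number,
   with p = h2,
     2^E sum_s GT(1^p s 1^p) GT(1^p (~s) 1^p)      (s of length w - h2).
   By Weyl's dimension formula GT is a product of differences of positions, so the
   summand is a constant times GT(s) GT(~s), and sum_s GT(s) GT(~s) = 2^(e f) over
   the s with e true and f false bits, again by B W^k = 2^k W^k.  Counting particles
   gives e = w - h3 = h1 - h2, without which there are no tilings. *)

Set Implicit Arguments.
Unset Strict Implicit.
Unset Printing Implicit Defensive.

Import Order.TTheory GRing.Theory Num.Theory.

(** * Zigzag transfer operators *)

Fixpoint bits (n : nat) : seq bitseq :=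
  if n is m.+1 then map (cons true) (bits m) ++ map (cons false) (bits m)
  else [:: [::]].

Lemma big_bitsS n (F : bitseq -> nat) :
  \sum_(y <- bits n.+1) F y =
  \sum_(y <- bits n) F (true :: y) + \sum_(y <- bits n) F (false :: y).
Proof. by rewrite /= big_cat !big_map. Qed.

Lemma big_bits0 (F : bitseq -> nat) : \sum_(y <- bits 0) F y = F [::].
Proof. by rewrite /= big_seq1. Qed.

Lemma size_bits n y : y \in bits n -> size y = n.
Proof.
elim: n y => [|n IH] y /=; first by rewrite inE => /eqP ->.
by rewrite mem_cat => /orP[] /mapP[z /IH <- ->].
Qed.

Definition neg : bitseq -> bitseq := map negb.

Lemma negK : involutive neg.
Proof. by move=> s; rewrite /neg -map_comp map_id_in // => b _ /=; rewrite negbK. Qed.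

Lemma size_neg s : size (neg s) = size s.
Proof. exact: size_map. Qed.

Lemma big_bits_neg n (F : bitseq -> nat) :
  \sum_(y <- bits n) F (neg y) = \sum_(y <- bits n) F y.
Proof.
elim: n F => [|n IH] F; first by rewrite !big_bits0.
by rewrite !big_bitsS /= addnC (IH (F \o cons true)) (IH (F \o cons false)).
Qed.

(* Whether the path v_0 u_0 v_1 ... u_(n-1) v_n, restricted to the vertices with
   true bits, has a perfect matching when v_0 is already matched from outside iff
   p holds. *)
Fixpoint zigzag (p : bool) (v u : bitseq) : bool :=
  match v, u with
  | b :: v', [::] => (v' == [::]) && (p == b)
  | b :: v', c :: u' =>
      [&& p ==> b, p (+) b ==> c & zigzag (p (+) b (+) c) v' u']
  | [::], _ => false
  end.

Notation matched := (zigzag false).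
(* Deleting matched neighbours from the alternating path leaves an alternating
   path v u v ... v, so this says that the true bits of u interlace those of v. *)
Definition interlaced (v u : bitseq) : bool := matched (neg v) (neg u).

(* The induction for zigzag_comm needs all states of the two automata. *)
Definition up_down (p q : bool) (s x : bitseq) : nat :=
  \sum_(y <- bits (size s).+1) zigzag p y s * zigzag q (neg y) (neg x).
Definition down_up (p q : bool) (s x : bitseq) : nat :=
  \sum_(z <- bits (size s).-1) zigzag p (neg s) (neg z) * zigzag q x z.

Lemma up_down_cons p q s0 s x0 x :
  up_down p q (s0 :: s) (x0 :: x) =
  \sum_(b <- [:: true; false])
     [&& p ==> b, p (+) b ==> s0, q ==> ~~ b & q (+) ~~ b ==> ~~ x0]
      * up_down (p (+) b (+) s0) (q (+) ~~ b (+) ~~ x0) s x.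
Proof.
rewrite /up_down [size _]/= big_bitsS !big_cons big_nil addn0 !big_distrr /=.
by congr (_ + _); apply: eq_bigr => y _;
  case: p; case: s0; case: q; case: x0; rewrite /= ?mul1n ?muln0.
Qed.

Lemma down_up_cons p q s0 s1 s x0 x :
  down_up p q [:: s0, s1 & s] (x0 :: x) =
  \sum_(c <- [:: true; false])
     [&& p ==> ~~ s0, p (+) ~~ s0 ==> ~~ c, q ==> x0 & q (+) x0 ==> c]
      * down_up (p (+) ~~ s0 (+) ~~ c) (q (+) x0 (+) c) (s1 :: s) x.
Proof.
rewrite /down_up [(size _).-1]/= [(size (s1 :: s)).-1]/=.
rewrite big_bitsS !big_cons big_nil addn0 !big_distrr /=.
by congr (_ + _); apply: eq_bigr => z _;
  case: p; case: s0; case: q; case: x0; rewrite /= ?mul1n ?muln0.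
Qed.

(** Peeling one letter off both strings expresses each pair of states through others, and these four
    relations are closed under that recursion; the third is the one wanted. The last needs a
    nonempty [s]: on empty strings [up_down true false] is 1 while [down_up] vanishes. *)
Lemma up_down_states s x : size s = size x ->
  [/\ up_down true true s x = 0,
      up_down true false s x = up_down false true s x,
      up_down false false s x = (down_up false false s x).*2
    & 0 < size s -> up_down true false s x =
                    down_up true false s x + down_up false true s x].
Proof.
elim: s x => [|s0 s IH] [|x0 x] //= => [_|[sz]].
  by rewrite /up_down /down_up !unlock /=; split.
have [L11 L10 L00 LR] := IH x sz.
(* [down_up_cons] consumes one of at least two letters, so strings of length one are checked
   directly. *)
case: s sz L11 L10 L00 LR {IH} => [|s1 s] sz L11 L10 L00 LR.
  by case: x sz {L11 L10 L00 LR} => // _; case: s0; case: x0;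
     rewrite /up_down /down_up !unlock /=.
rewrite !up_down_cons !down_up_cons !big_cons !big_nil.
by case: s0; case: x0; rewrite /= ?L11 ?L00 -?L10 ?(LR isT); split; lia.
Qed.

(** The spider move B W = 2 W B, written on matrix entries. *)
Lemma zigzag_comm s x : size s = size x ->
  \sum_(y <- bits (size s).+1) matched y s * interlaced y x =
  (\sum_(z <- bits (size s).-1) interlaced s z * matched x z).*2.
Proof. by move=> sz; case: (up_down_states sz). Qed.

(* up and down: the bit sequence gets longer or shorter by one; black and white:
   the colour of the row being left. *)
Definition up_black (F : bitseq -> nat) (x : bitseq) : nat :=
  \sum_(y <- bits (size x).-1) matched x y * F y.
Definition up_white (F : bitseq -> nat) (x : bitseq) : nat :=
  \sum_(y <- bits (size x).-1) interlaced x y * F y.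
Definition down_black (F : bitseq -> nat) (x : bitseq) : nat :=
  \sum_(y <- bits (size x).+1) matched y x * F y.
Definition down_white (F : bitseq -> nat) (x : bitseq) : nat :=
  \sum_(y <- bits (size x).+1) interlaced y x * F y.

Section Operators.
Implicit Types (F G : bitseq -> nat) (x y : bitseq).

Lemma up_black_neg F x : up_black (F \o neg) (neg x) = up_white F x.
Proof.
rewrite /up_black size_neg -big_bits_neg.
by apply: eq_bigr => y _; rewrite /= negK.
Qed.

Lemma down_black_neg F x : down_black (F \o neg) (neg x) = down_white F x.
Proof.
rewrite /down_black size_neg -big_bits_neg.
by apply: eq_bigr => y _; rewrite /= negK.
Qed.

Lemma up_white_neg F x : up_white (F \o neg) (neg x) = up_black F x.
Proof.
rewrite -[in RHS](negK x) -(up_black_neg (F \o neg)) negK.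
by apply: eq_bigr => y _; rewrite /= negK.
Qed.

Lemma eq_up_white F G : F =1 G -> up_white F =1 up_white G.
Proof. by move=> FG x; apply: eq_bigr => y _; rewrite FG. Qed.
Lemma eq_up_black F G : F =1 G -> up_black F =1 up_black G.
Proof. by move=> FG x; apply: eq_bigr => y _; rewrite FG. Qed.
Lemma eq_down_white F G : F =1 G -> down_white F =1 down_white G.
Proof. by move=> FG x; apply: eq_bigr => y _; rewrite FG. Qed.
Lemma eq_down_black F G : F =1 G -> down_black F =1 down_black G.
Proof. by move=> FG x; apply: eq_bigr => y _; rewrite FG. Qed.

Lemma up_whiteZ c F x : up_white (fun y => c * F y) x = c * up_white F x.
Proof. by rewrite /up_white big_distrr; apply: eq_bigr => y _; rewrite mulnCA. Qed.
Lemma up_blackZ c F x : up_black (fun y => c * F y) x = c * up_black F x.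
Proof. by rewrite /up_black big_distrr; apply: eq_bigr => y _; rewrite mulnCA. Qed.
Lemma down_whiteZ c F x : down_white (fun y => c * F y) x = c * down_white F x.
Proof. by rewrite /down_white big_distrr; apply: eq_bigr => y _; rewrite mulnCA. Qed.
Lemma down_black_up_white F x :
  down_black (up_white F) x = 2 * up_white (down_black F) x.
Proof.
rewrite /down_black /up_white.
under eq_big_seq => y /size_bits-> /= do rewrite big_distrr /=.
rewrite exchange_big /=.
under eq_big_seq => y /size_bits sy.
  under eq_bigr => z _ do rewrite mulnA.
  rewrite -big_distrl /= (zigzag_comm (esym sy)).
  over.
(* For empty [x] the truncated predecessor makes the lengths disagree, but nothing interlaces with
   [[::]], so both sides are 0. *)
case: x => [|b x].
  rewrite /= big_seq1 -muln2 big1_seq ?muln0 //.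
have -> : \sum_(y <- bits (size (b :: x)).-1) interlaced (b :: x) y *
      \sum_(z <- bits (size y).+1) matched z y * F z =
    \sum_(z <- bits (size (b :: x))) \sum_(y <- bits (size (b :: x)).-1)
      interlaced (b :: x) y * (matched z y * F z).
  rewrite exchange_big; apply: eq_big_seq => y /size_bits ->.
  by rewrite big_distrr.
rewrite big_distrr; apply: eq_bigr => y _ /=.
rewrite -mul2n -mulnA; congr (2 * _).
by rewrite big_distrl; apply: eq_bigr => z _; rewrite /= mulnA.
Qed.

Lemma down_white_up_black F x :
  down_white (up_black F) x = 2 * up_black (down_white F) x.
Proof.
rewrite -down_black_neg -up_white_neg.
under eq_up_white => y do rewrite /= -down_black_neg negK.
under eq_down_black => y do rewrite /= -up_white_neg negK.
exact: down_black_up_white.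
Qed.

Definition pairing (n : nat) F G : nat := \sum_(x <- bits n) F x * G x.

(** Both operators sum against the kernel [matched], one over its second and one over its first
    argument, so they are adjoint. *)
Lemma pairing_up_black n F G :
  pairing n.+1 (up_black F) G = pairing n F (down_black G).
Proof.
rewrite /pairing /up_black /down_black.
under eq_big_seq => y /size_bits-> /= do rewrite big_distrl /=.
under [RHS]eq_big_seq => y /size_bits-> /= do rewrite big_distrr /=.
rewrite [RHS]exchange_big; apply: eq_bigr => x _; apply: eq_bigr => y _.
by rewrite mulnAC mulnC.
Qed.

Lemma pairing_neg n F G : pairing n (F \o neg) (G \o neg) = pairing n F G.
Proof. exact: (big_bits_neg n (fun x => F x * G x)). Qed.

Lemma eq_pairing n F F' G G' : (forall x, size x = n -> F x = F' x) ->
  (forall x, size x = n -> G x = G' x) -> pairing n F G = pairing n F' G'.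
Proof. by move=> FF GG; apply: eq_big_seq => x /size_bits sx; rewrite FF ?GG. Qed.

Lemma pairing_up_white n F G :
  pairing n.+1 (up_white F) G = pairing n F (down_white G).
Proof.
rewrite -pairing_neg.
rewrite (eq_pairing (F' := up_black (F \o neg)) (G' := G \o neg)) //; last first.
  by move=> x _; rewrite /= -up_black_neg negK.
rewrite pairing_up_black -pairing_neg; apply: eq_pairing => x _ /=.
  by rewrite negK.
exact: down_black_neg.
Qed.

End Operators.

(* The number of Gelfand-Tsetlin patterns whose top row is the set of positions
   of the k true bits. *)
Fixpoint patterns (k : nat) : bitseq -> nat :=
  if k is j.+1 then up_white (patterns j) else fun x => all negb x.

(** [patterns k] is [k] interlacings applied to the indicator of the empty configuration, which
    [down_black] fixes; passing each interlacing costs a factor 2. *)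
Lemma down_black_patterns k x : down_black (patterns k) x = 2 ^ k * patterns k x.
Proof.
elim: k x => [|k IH] x.
  rewrite mul1n /down_black /=.
  suff E p : \sum_(y <- bits (size x).+1) zigzag p y x * all negb y =
      ~~ p && all negb x by rewrite E.
  elim: x p => [|b x IH] p; first by rewrite big_bitsS !big_bits0; case: p.
  rewrite [size _]/= big_bitsS big1 ?add0n => [|y _]; last by rewrite muln0.
  by case: p => /=; [rewrite big1 | case: b; rewrite IH].
by rewrite [patterns _]/= down_black_up_white (eq_up_white IH) up_whiteZ expnS mulnA.
Qed.

Lemma down_white_patterns_neg k x :
  down_white (patterns k \o neg) x = 2 ^ k * patterns k (neg x).
Proof.
rewrite -down_black_neg -down_black_patterns.
by apply: eq_bigr => y _; rewrite /= negK.
Qed.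

(** A perfect matching pairs the true bits of [v] with those of [u], except that under [p] the first
    vertex of [v] has its partner outside. *)
Lemma zigzag_count p v u : zigzag p v u -> count id v = count id u + p.
Proof.
elim: v p u => [|b v IH] p [|c u] //=.
  by case/andP => /eqP -> /eqP ->; rewrite addn0.
by case/and3P => pb bc /IH ->; case: p b c pb bc => [] [] [] //= _ _; lia.
Qed.

Lemma zigzag_size p v u : zigzag p v u -> size v = (size u).+1.
Proof.
elim: v p u => [|b v IH] p [|c u] //=; first by case/andP => /eqP ->.
by case/and3P => _ _ /IH ->.
Qed.

Lemma count_neg x : count id (neg x) + count id x = size x.
Proof. by rewrite addnC -(count_predC id x) /neg count_map. Qed.

Lemma interlaced_count v u : interlaced v u -> count id v = (count id u).+1.
Proof.
move=> vu; have := zigzag_size vu; have := zigzag_count vu.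
by rewrite !size_neg; have := count_neg v; have := count_neg u; lia.
Qed.

Lemma patterns_count k x : patterns k x != 0 -> count id x = k.
Proof.
elim: k x => [|k IH] x /=.
  rewrite eqb0 negbK => /allP nx.
  by apply/eqP; rewrite -leqn0 leqNgt -has_count; apply/hasP => -[b /nx]; case: b.
rewrite /up_white => P.
have /hasP[y _] : has (fun y => 0 < interlaced x y * patterns k y) (bits (size x).-1).
  apply: contraNT P => /hasPn Z.
  by rewrite big1_seq // => y /= /Z; rewrite -eqn0Ngt => /eqP.
rewrite muln_gt0 lt0b => /andP[/interlaced_count -> ].
by rewrite lt0n => /IH ->.
Qed.

(** * Downward interlacings as padding with particles *)

Definition cap (p : nat) (x : bitseq) : bitseq := nseq p true ++ x ++ nseq p true.

Lemma nseq_shift p (b : bool) x : b :: nseq p b ++ x = nseq p b ++ b :: x.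
Proof. by elim: p => //= p ->. Qed.

Lemma capS p x : cap p.+1 x = true :: rcons (cap p x) true.
Proof. by rewrite /cap -cats1 -!catA -nseq_shift cats0. Qed.

(** Between two consecutive particles of the longer row lies exactly one of the shorter. If they are
    adjacent, only one place is left for it, so a leading run of [p.+1] particles forces a run of
    [p]. *)
Lemma big_interlaced_prefix p n v (G : bitseq -> nat) :
  \sum_(z <- bits (p + n)) interlaced (nseq p true ++ true :: v) z * G z =
  \sum_(z <- bits n) interlaced (true :: v) z * G (nseq p true ++ z).
Proof.
elim: p G => [|p IH] G //.
rewrite addSn big_bitsS [X in _ + X]big1 ?addn0 => [|z _].
  exact: (IH (fun z => G (true :: z))).
by case: p {IH} => [|p]; case: z => [|b z]; rewrite /interlaced /= ?andbF.
Qed.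

(** The same forcing at the right end, one place at a time. Since [zigzag] reads from the left, the
    induction on [v] needs every state [q]. *)
Lemma big_zigzag_suffix n q v (G : bitseq -> nat) : size v = n ->
  \sum_(z <- bits n.+1) zigzag q (rcons (rcons v false) false) (neg z) * G z =
  \sum_(z <- bits n) zigzag q (rcons v false) (neg z) * G (rcons z true).
Proof.
elim: v n q G => [|b v IH] [|n] q G //= => [_|[sv]].
  by case: q; rewrite !unlock /=.
rewrite -[_ ++ _]/(bits n.+2) -[_ ++ _ in RHS]/(bits n.+1).
rewrite [LHS]big_bitsS [RHS]big_bitsS.
have step c : \sum_(z <- bits n.+1) zigzag q (b :: rcons (rcons v false) false)
      (neg (c :: z)) * G (c :: z) =
    \sum_(z <- bits n) zigzag q (b :: rcons v false) (neg (c :: z)) *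
      G (rcons (c :: z) true).
  have E (w z : bitseq) : zigzag q (b :: w) (neg (c :: z)) =
    (q ==> b) && (q (+) b ==> ~~ c) && zigzag (q (+) b (+) ~~ c) w (neg z) :> bool.
    by rewrite /= andbA.
  under eq_bigr do rewrite E -mulnb -mulnA.
  under [RHS]eq_bigr do rewrite E -mulnb -mulnA.
  by rewrite -!big_distrr (IH n _ (fun z => G (c :: z))).
by rewrite !step.
Qed.

Lemma big_interlaced_suffix p n q v (G : bitseq -> nat) : size v = n ->
  \sum_(z <- bits (p + n)) zigzag q (neg (v ++ nseq p.+1 true)) (neg z) * G z =
  \sum_(z <- bits n) zigzag q (neg (rcons v true)) (neg z) * G (z ++ nseq p true).
Proof.
elim: p n v G => [|p IH] n v G sv.
  by rewrite cats1; apply: eq_bigr => z _; rewrite cats0.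
rewrite -[nseq p.+2 _]/(true :: nseq p.+1 true) -cat_rcons addSnnS IH ?size_rcons ?sv //.
rewrite /neg !map_rcons (big_zigzag_suffix _ (fun z => G (z ++ nseq p true))) ?size_map //.
by apply: eq_bigr => z _; rewrite cat_rcons.
Qed.

(** Deleting both end vertices leaves a path that starts and ends in [y]; its first vertex is taken
    from outside exactly when [b] still needs a partner, that is, for [p (+) b]. *)
Lemma zigzag_shift p b x y : size y = (size x).+1 ->
  zigzag p (b :: rcons x false) y = (p ==> b) && zigzag (p (+) b) y x.
Proof.
elim: x y p b => [|c x IH] [|d y] p b //= [] sy.
  by case: y sy => //= _; case: p; case: b; case: d.
by rewrite -/(zigzag _ (c :: _) _) IH -?andbA.
Qed.

(** With a particle added beyond either end, [x] becomes the longer row and [y] fits between its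
    entries. A downward interlacing can thus be read as an upward one. *)
Lemma interlaced_shift x y : size y = (size x).+1 ->
  interlaced (true :: rcons x true) y = interlaced y x.
Proof.
move=> sy; rewrite /interlaced.
have -> : neg (true :: rcons x true) = false :: rcons (neg x) false.
  by rewrite /neg /= map_rcons.
by rewrite zigzag_shift // !size_neg.
Qed.

(** The outer runs of true bits force runs in the next row that are shorter by one, and
    [interlaced_shift] treats the part between them. *)
Lemma down_white_cap k p x :
  down_white (fun y => patterns k (cap p y)) x = patterns k.+1 (cap p.+1 x).
Proof.
rewrite [RHS]/= /up_white capS /=.
have -> : size (rcons (cap p x) true) = p + (p + (size x).+1).
  by rewrite size_rcons /cap !size_cat !size_nseq; lia.
have -> : true :: rcons (cap p x) true =
    nseq p true ++ true :: (x ++ nseq p.+1 true).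
  by rewrite -capS /cap /= nseq_shift.
rewrite big_interlaced_prefix (big_interlaced_suffix p false (v := true :: x)) //.
apply: eq_big_seq => y /size_bits sy.
by rewrite -/(interlaced _ _) /= interlaced_shift.
Qed.

Lemma iter_down_white_patterns k p x :
  iter p down_white (patterns k) x = patterns (k + p) (cap p x).
Proof.
elim: p x => [|p IH] x; first by rewrite addn0 /cap /= cats0.
by rewrite iterS (eq_down_white IH) down_white_cap addnS.
Qed.

Lemma patterns_full n : patterns n (nseq n true) = 1.
Proof.
elim: n => // n IH; rewrite /= /up_white /= size_nseq.
have := big_interlaced_prefix n 0 [::] (patterns n).
rewrite addn0 big_bits0 cats0 IH -nseq_shift cats0 => ->.
by rewrite /interlaced.
Qed.

(** By adjointness each interlacing in [patterns e] is moved onto [patterns f \o neg], where it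
    amounts to a factor [2 ^ f]. *)
Lemma sum_patterns_neg e f :
  \sum_(s <- bits (e + f)) patterns e s * patterns f (neg s) = 2 ^ (e * f).
Proof.
elim: e => [|e IH].
  rewrite add0n mul0n expn0 -(patterns_full f) -big_bits_neg.
  under eq_bigr do rewrite negK.
  elim: f (patterns f) => [|f IH] G; first by rewrite big_bits0 mul1n.
  rewrite big_bitsS [X in _ + X]big1 ?addn0 //=.
rewrite addSn -/(pairing _ _ (patterns f \o neg)) pairing_up_white /pairing.
under eq_bigr do rewrite down_white_patterns_neg mulnCA.
by rewrite -big_distrr /= IH mulSn expnD.
Qed.

(** * Weyl's dimension formula *)

Fixpoint positions (i : nat) (x : bitseq) : seq nat :=
  if x is b :: x' then
    if b then i :: positions i.+1 x' else positions i.+1 x'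
  else [::].

Lemma size_positions i x : size (positions i x) = count id x.
Proof. by elim: x i => //= -[] x IH i /=; rewrite IH. Qed.

Lemma positions_path i j x : i <= j -> path leq i (positions j x).
Proof.
elim: x i j => //= b x IH i j ij.
case: b => /=; last by apply: IH; lia.
by rewrite ij IH.
Qed.

Local Open Scope ring_scope.

Section InterlacingSums.
Variable R : pzRingType.
Implicit Type g : seq nat -> R.

(** The sum over all rows interlacing with [y :: ys]. The gaps are half-open: an entry may share the
    place of the particle to its left, not of the one to its right. *)
Fixpoint gap_sum (y : nat) (ys : seq nat) g : R :=
  if ys is y' :: ys' then
    \sum_(y <= x < y') gap_sum y' ys' (fun xs => g (x :: xs))
  else g [::].

Definition gap_sum0 ys g : R := if ys is y :: ys' then gap_sum y ys' g else 0.

Lemma sum_bitsS n (F : bitseq -> R) :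
  \sum_(y <- bits n.+1) F y =
  \sum_(y <- bits n) F (true :: y) + \sum_(y <- bits n) F (false :: y).
Proof. by rewrite /= big_cat !big_map. Qed.

(** The two equations are proved together: the first treats a row once a particle at place [i] has
    been read, the second a row whose first particle may still be ahead. *)
Lemma interlaced_gap_sum v i g :
  \sum_(u <- bits (size v)) (interlaced (true :: v) u)%:R * g (positions i u)
    = gap_sum i (positions i.+1 v) g
  /\ \sum_(u <- bits (size v).-1) (interlaced v u)%:R * g (positions i u)
    = gap_sum0 (positions i v) g.
Proof.
elim: v i g => [|b v IH] i g.
  by rewrite /= !big_seq1 /= mul1r mul0r.
split; last first.
  case: b => /=; first by have [-> _] := IH i g.
  case: v IH => [|c v] IH; first by rewrite /= big_seq1 mul0r.
  have [_ <-] := IH i.+1 g.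
  rewrite [size _]/= sum_bitsS big1 ?add0r => [|u _].
    by apply: eq_bigr.
  by rewrite /interlaced /= mul0r.
have [IHA _] := IH i.+1 (fun xs => g (i :: xs)).
have [_ IHB] := IH i.+2 (fun xs => g (i :: xs)).
have [IHA' _] := IH i.+1 g.
rewrite [size _]/= sum_bitsS.
case: b.
  rewrite [X in _ + X]big1 ?addr0 => [|u _].
    by rewrite /= big_nat1 -IHA; apply: eq_bigr.
  by case: u => [|c u]; rewrite /interlaced /= ?andbF mul0r.
(* The entry of the first gap lies beyond [i] or at [i], according to the first bit of the shorter
   row. *)
have -> : \sum_(y <- bits (size v))
      (interlaced [:: true, false & v] (false :: y))%:R * g (positions i (false :: y))
    = gap_sum i.+1 (positions i.+2 v) g.
  by rewrite -IHA'; apply: eq_bigr.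
have -> : \sum_(y <- bits (size v))
      (interlaced [:: true, false & v] (true :: y))%:R * g (positions i (true :: y))
    = gap_sum0 (positions i.+2 v) (fun xs => g (i :: xs)).
  case: v {IH IHA IHA'} IHB => [|c v] IHB.
    by rewrite big_seq1; apply: mul0r.
  rewrite -IHB [size _]/= sum_bitsS [X in X + _]big1 ?add0r => [|u _].
    by apply: eq_bigr.
  by rewrite /interlaced /= mul0r.
have := @positions_path i.+2 i.+2 v (leqnn _).
rewrite [positions _ (false :: v)]/=; case: (positions i.+2 v) => [|y ys] /=.
  by rewrite add0r.
by case/andP => iy _; rewrite [RHS]big_ltn // ltnW.
Qed.

End InterlacingSums.

Lemma gap_sum_sum (R : pzRingType) (I : Type) (r : seq I) y ys
    (a : I -> R) (g : I -> seq nat -> R) :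
  gap_sum y ys (fun xs => \sum_(i <- r) a i * g i xs) =
  \sum_(i <- r) a i * gap_sum y ys (g i).
Proof.
elim: ys y g => //= z ys IH y g.
under eq_bigr do rewrite IH.
by rewrite exchange_big; apply: eq_bigr => i _; rewrite big_distrr.
Qed.

Lemma eq_gap_sum (R : pzRingType) y ys (g g' : seq nat -> R) :
  (forall xs, size xs = size ys -> g xs = g' xs) ->
  gap_sum y ys g = gap_sum y ys g'.
Proof.
elim: ys y g g' => /= [|z ys IH] y g g' gg'; first exact: gg'.
by apply: eq_bigr => x _; apply: IH => xs sxs; rewrite gg' //= sxs.
Qed.

(** Each entry of [xs] affects only its own row of the matrix and ranges independently over its gap,
    so multilinearity moves the sums into the rows. *)
Lemma gap_sum_det (R : comPzRingType) k ys y (phi : nat -> nat -> R) :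
  size ys = k ->
  gap_sum y ys (fun xs => \det (\matrix_(i < k, j < k) phi j (nth 0%N xs i)))
  = \det (\matrix_(i < k, j < k)
      \sum_(nth 0%N (y :: ys) i <= x < nth 0%N ys i) phi j x).
Proof.
(* Expansion along the first row deletes an arbitrary column, hence the general family [col]. *)
suff gen (col : 'I_k -> nat -> R) : size ys = k ->
    gap_sum y ys (fun xs => \det (\matrix_(i < k, j < k) col j (nth 0%N xs i)))
    = \det (\matrix_(i < k, j < k)
         \sum_(nth 0%N (y :: ys) i <= x < nth 0%N ys i) col j x).
  exact: gen.
elim: ys y k col => [|z ys IH] y [|k] col //= => [_|[sk]].
  by rewrite !det_mx00.
rewrite [RHS](expand_det_row _ ord0).
pose minor (j : 'I_k.+1) (xs : seq nat) :=
  \det (\matrix_(i < k, l < k) col (lift j l) (nth 0%N xs i)).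
have expand x xs : \det (\matrix_(i < k.+1, j < k.+1) col j (nth 0%N (x :: xs) i))
    = \sum_(j < k.+1) ((-1) ^+ j * col j x) * minor j xs.
  rewrite (expand_det_row _ ord0); apply: eq_bigr => j _.
  rewrite mxE /= /cofactor mulrCA -mulrA add0n.
  congr (_ * (_ * \det _)).
  by apply/matrixP => i l; rewrite !mxE.
under eq_bigr => x _ do under eq_gap_sum => xs _ do rewrite expand.
under eq_bigr do rewrite gap_sum_sum.
rewrite exchange_big; apply: eq_bigr => j _ /=.
rewrite mxE -big_distrl -big_distrr /= (IH _ _ (fun l => col (lift j l))) //.
rewrite /cofactor add0n mulrCA mulrA.
congr (_ * \det _); apply/matrixP => i l; rewrite !mxE.
by [].
Qed.

Lemma sum_binomial (R : pzRingType) (a b j : nat) : (a <= b)%N ->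
  \sum_(a <= x < b) ('C(x, j))%:R = ('C(b, j.+1))%:R - ('C(a, j.+1))%:R :> R.
Proof.
move=> ab; apply: (telescope_sumr_eq (fun x => ('C(x, j.+1))%:R)) => // x _.
by rewrite binS natrD addrAC subrr add0r.
Qed.

(** A Vandermonde determinant in the binomial basis, in which sums over gaps telescope. *)
Definition binomial_det (R : comPzRingType) (k : nat) (ys : seq nat) : R :=
  \det (\matrix_(i < k, j < k) ('C(nth 0%N ys i, j))%:R).

(** Summing C(x, j) over a gap gives a difference of two values of C(x, j + 1). These are the
    differences of consecutive rows of the larger matrix, whose column 0 consists of ones. *)
Lemma gap_sum_binomial_det (R : comPzRingType) k y ys :
  size ys = k -> path leq y ys ->
  gap_sum y ys (binomial_det R k) = binomial_det R k.+1 (y :: ys).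
Proof.
move=> sk ysP.
rewrite (gap_sum_det y (fun j x => ('C(x, j))%:R)) // /binomial_det.
set M := (X in _ = \det X).
(* Left multiplication by [L] subtracts from each row the preceding one; column 0 then keeps a
   single nonzero entry, at the top. *)
pose L : 'M[R]_k.+1 := \matrix_(i, j) ((i == j)%:R - (i == j.+1 :> nat)%:R).
have detL : \det L = 1.
  rewrite det_trig; last first.
    apply/is_trig_mxP => i j ij; rewrite mxE.
    by rewrite -val_eqE /= (ltn_eqF ij) (ltn_eqF (ltnW ij : (i < j.+1)%N)) subrr.
  by apply: big1 => i _; rewrite mxE eqxx ltn_eqF ?subr0.
have LM0 j : (L *m M) ord0 j = M ord0 j.
  rewrite mxE (bigD1 ord0) //= mxE eqxx subr0 mul1r big1 ?addr0 // => l l0.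
  by rewrite mxE eq_sym (negbTE l0) subr0 mul0r.
have LMS i j : (L *m M) (lift ord0 i) j = M (lift ord0 i) j - M (widen_ord (leqnSn k) i) j.
  rewrite mxE (eq_bigr (fun l => (lift ord0 i == l)%:R * M l j -
      (widen_ord (leqnSn k) i == l)%:R * M l j)) => [|l _].
    rewrite big_split /= sumrN.
    have pick i' : \sum_(l < k.+1) (i' == l)%:R * M l j = M i' j.
      rewrite (bigD1 i') //= eqxx mul1r big1 ?addr0 // => l li.
      by rewrite eq_sym (negbTE li) mul0r.
    by rewrite !pick.
  by rewrite mxE mulrBl.
have -> : \det M = \det (L *m M) by rewrite det_mulmx detL mul1r.
rewrite [RHS](expand_det_col _ ord0) big_ord_recl big1; last first.
  move=> i _; rewrite LMS !mxE !bin0 subrr mul0r //.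
rewrite addr0 LM0 mxE bin0 mul1r /cofactor expr0 mul1r.
congr (\det _); apply/matrixP => i j; rewrite [LHS]mxE [RHS]mxE [RHS]mxE LMS !mxE.
apply: sum_binomial.
have /pathP := ysP; move/(_ 0%N i); apply.
by rewrite sk.
Qed.

(** j! C(x, j) is the falling factorial, a monic polynomial of degree j in x. The scaled matrix is
    therefore a Vandermonde matrix times the unitriangular matrix [P] of coefficients. *)
Lemma binomial_detE (R : comNzRingType) k ys :
  binomial_det R k ys * \prod_(j < k) (j`!)%:R =
  \prod_(i < k) \prod_(j < k | (i < j)%N) ((nth 0%N ys j)%:R - (nth 0%N ys i)%:R).
Proof.
pose a := \row_(i < k) ((nth 0%N ys i)%:R : R).
pose p j : {poly R} := \prod_(m < j) ('X - (m%:R)%:P).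
pose P : 'M[R]_k := \matrix_(m, j) (p j)`_m.
have sp j : size (p j) = j.+1.
  by rewrite /p -big_enum size_prod_XsubC size_enum_ord.
have detP : \det P = 1.
  rewrite -det_tr det_trig; last first.
    by apply/is_trig_mxP => i j ij; rewrite !mxE nth_default // sp.
  apply: big1 => i _; rewrite !mxE.
  have /monicP := monic_prod_XsubC (index_enum 'I_i) xpredT
    (fun m => (nat_of_ord m)%:R : R).
  by rewrite lead_coefE -/(p i) sp.
have pE j y : (p j).[y%:R] = (y ^_ j)%:R.
  rewrite /p; elim: j => [|j IH]; first by rewrite big_ord0 hornerC.
  rewrite big_ord_recr hornerM IH hornerXsubC ffactnSr natrM.
  case: (leqP j y) => jy; first by rewrite natrB.
  by rewrite ffact_small ?mul0r.
have -> : binomial_det R k ys * \prod_(j < k) (j`!)%:R =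
    \det ((Vandermonde k a)^T *m P).
  rewrite (_ : \prod_(j < k) _ = \det (diag_mx (\row_(j < k) (j`!)%:R))); last first.
    by rewrite det_diag; apply: eq_bigr => j _; rewrite mxE.
  rewrite -det_mulmx; congr (\det _); apply/matrixP => i j.
  rewrite mul_mx_diag !mxE -natrM bin_ffact -pE.
  rewrite (horner_coef_wide _ (n := k)) ?sp //.
  by apply: eq_bigr => m _; rewrite !mxE mulrC.
rewrite det_mulmx det_tr detP mulr1 det_Vandermonde.
by apply: eq_bigr => i _; apply: eq_bigr => j _; rewrite !mxE.
Qed.

Lemma patterns_binomial_det k x : count id x = k ->
  (patterns k x)%:R = binomial_det int k (positions 0 x).
Proof.
elim: k x => [|k IH] x xk.
  rewrite /binomial_det det_mx00 /= (_ : all negb x = true) //.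
  by rewrite all_count -(count_predC id) xk add0n; apply: eqxx.
have -> : (patterns k.+1 x)%:R = gap_sum0 (positions 0 x) (binomial_det int k).
  have [_ <-] := interlaced_gap_sum x 0 (binomial_det int k).
  rewrite [patterns _]/= /up_white natr_sum.
  apply: eq_bigr => u _; rewrite natrM.
  case: (boolP (interlaced x u)) => [/interlaced_count|]; last by rewrite !mul0r.
  by rewrite xk => -[] ku; rewrite IH.
have := size_positions 0 x; have := positions_path x (leqnn 0).
case: (positions 0 x) => [|y ys]; rewrite xk //= => yP [sy].
by rewrite gap_sum_binomial_det.
Qed.

Local Close Scope ring_scope.

(** * Products of differences for complementary configurations *)

Fixpoint shifted_prod (x : nat) (s : bitseq) : nat :=
  if s is b :: s' then (if b then x else 1) * shifted_prod x.+1 s' else 1.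

(* The product of the differences of the positions of the true bits. *)
Fixpoint spread (s : bitseq) : nat :=
  if s is b :: s' then (if b then shifted_prod 1 s' else 1) * spread s' else 1.

(** The product of the differences of [n] consecutive positions, the denominator in Weyl's
    formula. *)
Definition superfact (n : nat) : nat := \prod_(i < n) i`!.

Lemma superfactS n : superfact n.+1 = superfact n * n`!.
Proof. exact: big_ord_recr. Qed.

Lemma superfact_gt0 n : 0 < superfact n.
Proof. by apply: prodn_gt0 => i; exact: fact_gt0. Qed.

(** [shifted_prod d s] collects the distances to the particles of [s] from a place [d] before the
    start of [s]. *)
Lemma prod_positions i d s :
  (\prod_(y <- positions (i + d) s) (y%:R - i%:R) = (shifted_prod d s)%:R :> int)%R.
Proof.
elim: s d => [|b s IH] d; first by rewrite big_nil.
case: b => /=; rewrite -addnS ?mul1n ?IH // big_cons IH natrM.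
by rewrite natrD addrAC subrr add0r.
Qed.

Lemma vandermonde_positions i s k : count id s = k ->
  (\prod_(a < k) \prod_(b < k | (a < b)%N)
     ((nth 0%N (positions i s) b)%:R - (nth 0%N (positions i s) a)%:R)
  = (spread s)%:R :> int)%R.
Proof.
elim: s i k => [|b s IH] i k /=; first by move=> <-; rewrite big_ord0.
case: b => /= [<-|]; last by rewrite mul1n; apply: IH.
rewrite big_ord_recl natrM -(IH i.+1 _ erefl); congr (_ * _)%R.
  rewrite big_mkcond big_ord_recl /= mul1r -(prod_positions i 1) addn1.
  by rewrite (big_nth 0) big_mkord size_positions.
apply: eq_bigr => a _; rewrite big_mkcond big_ord_recl /= mul1r.
by rewrite [RHS]big_mkcond.
Qed.

(** Weyl's formula with the denominator moved to the left, which keeps it in the natural numbers. *)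
Lemma patterns_spread k x : count id x = k ->
  patterns k x * superfact k = spread x.
Proof.
move=> xk; apply/eqP; rewrite -(eqr_nat int) natrM (patterns_binomial_det xk).
by rewrite -(vandermonde_positions 0 xk) -binomial_detE /superfact natr_prod.
Qed.

(** The distances from the particles of [s] to one appended right after [s]. *)
Fixpoint end_prod (s : bitseq) : nat :=
  if s is b :: s' then (if b then size s else 1) * end_prod s' else 1.

Lemma spread_rcons s : spread (rcons s true) = spread s * end_prod s.
Proof.
have step x t : shifted_prod x (rcons t true) = shifted_prod x t * (x + size t).
  elim: t x => [|b t IH] x /=; first by rewrite muln1 mul1n addn0.
  by rewrite IH addSnnS mulnA.
elim: s => //= b s ->; case: b; rewrite ?mul1n // step add1n.
by lia.
Qed.

(** Each place of [s] holds a particle in exactly one of [s] and [neg s], while the [k] final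
    particles count twice; so the distances depend on [s] only through its length. *)
Lemma end_prod_pair k s :
  end_prod (s ++ nseq k true) * end_prod (neg s ++ nseq k true) =
  k`! * (size s + k)`!.
Proof.
have ones : end_prod (nseq k true) = k`!.
  by elim: k => //= k ->; rewrite size_nseq factS.
elim: s => [|b s IH] /=; first by rewrite ones.
rewrite !size_cat size_neg size_nseq.
by rewrite addSn factS [RHS]mulnCA -IH; case: b => /=; rewrite mul1n; ring.
Qed.

(** The same argument seen from the left: distances up to [x + size s] occur once, the next [p]
    twice. The factorials on the left replace a division. *)
Lemma shifted_prod_pair x s p :
  shifted_prod x.+1 (s ++ nseq p true) * shifted_prod x.+1 (neg s ++ nseq p true)
    * ((x + size s)`! * x`!) = (x + size s + p)`! ^ 2.
Proof.
elim: s x => [|b s IH] x /=.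
  have ones : shifted_prod x.+1 (nseq p true) * x`! = (x + p)`!.
    elim: p x => [|p IH] x /=; first by rewrite mul1n addn0.
    by rewrite addnS -addSn -IH factS; ring.
  by rewrite addn0 mulnACA ones -mulnn.
have := IH x.+1; rewrite addSn -addnS => <-.
by rewrite factS; case: b => /=; ring.
Qed.

Lemma shifted_prod_ones k s :
  shifted_prod 1 (nseq k true ++ s) = k`! * shifted_prod k.+1 s.
Proof.
elim: k s => [|k IH] s; first by rewrite mul1n.
by rewrite [nseq _ _ ++ _]/= nseq_shift IH /= factS; ring.
Qed.

Lemma spread_pair_right p s :
  spread (s ++ nseq p true) * spread (neg s ++ nseq p true) * superfact (size s)
  = superfact (size s + p) * superfact p * (spread s * spread (neg s)).
Proof.
elim: p => [|p IH].
  by rewrite !cats0 addn0 /superfact big_ord0 muln1 mulnC.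
have E t : t ++ nseq p.+1 true = rcons (t ++ nseq p true) true.
  by rewrite -cats1 -catA -nseq_shift cats0.
rewrite !E !spread_rcons addnS !superfactS mulnACA end_prod_pair mulnAC IH.
by ring.
Qed.

(** Particles are prepended one by one, so their number [k] has to be independent of the number [p]
    on the right. *)
Lemma spread_pair_left k p s :
  spread (nseq k true ++ s ++ nseq p true) *
    spread (nseq k true ++ neg s ++ nseq p true) *
    (superfact (size s + k) * superfact (size s + p) ^ 2)
  = superfact (size s) * superfact k * superfact (size s + p + k) ^ 2 *
    (spread (s ++ nseq p true) * spread (neg s ++ nseq p true)).
Proof.
elim: k => [|k IH].
  by rewrite !addn0 /superfact big_ord0; ring.
rewrite /= !shifted_prod_ones !addnS !superfactS.
have := shifted_prod_pair k s p; rewrite [k + _]addnC [_ + k + p]addnAC.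
move: IH; set AB := (_ * _ * (_ * superfact _ ^ 2)) => IH pair.
rewrite [LHS](_ : _ = k`! * (shifted_prod k.+1 (s ++ nseq p true) *
  shifted_prod k.+1 (neg s ++ nseq p true) * ((size s + k)`! * k`!)) * AB);
  last by rewrite /AB; ring.
by rewrite IH pair; ring.
Qed.

(** Padding multiplies the product for [s] and [neg s] by a factor depending only on the lengths,
    which can be taken out of the sum over [s]. *)
Lemma spread_cap_pair p s w : w = size s + p ->
  spread (cap p s) * spread (cap p (neg s)) * superfact w ^ 2 =
  superfact (w + p) ^ 2 * superfact p ^ 2 * (spread s * spread (neg s)).
Proof.
move=> ->; have := spread_pair_left p p s; have := spread_pair_right p s.
rewrite -/(cap p s) -/(cap p (neg s)); set m := size s => right left.
have pos : 0 < superfact (m + p) by exact: superfact_gt0.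
apply/eqP; rewrite -(eqn_pmul2l pos); apply/eqP.
rewrite mulnC -mulnA (mulnC (_ ^ 2)) left.
transitivity (superfact p * superfact (m + p + p) ^ 2 *
  (spread (s ++ nseq p true) * spread (neg s ++ nseq p true) * superfact m));
  first by ring.
by rewrite right; ring.
Qed.

Lemma patterns_pair_sum p e f w : w = e + f + p ->
  (\sum_(s <- bits (e + f)) patterns (e + p + p) (cap p s) *
                          patterns (f + p + p) (cap p (neg s))) *
    (superfact (e + p + p) * superfact (f + p + p) * superfact w ^ 2) =
  superfact (w + p) ^ 2 * superfact p ^ 2 * superfact e * superfact f *
    2 ^ (e * f).
Proof.
move=> wE; rewrite -sum_patterns_neg big_distrl big_distrr /=.
have capcount k s : count id (cap p s) = k + p + p <-> count id s = k.
  rewrite /cap !count_cat !count_nseq /=; split; lia.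
apply: eq_big_seq => s /size_bits ss.
(* With a wrong number of particles both summands vanish; otherwise the dimension formula applies to
   all four pattern counts. *)
case: (boolP (count id s == e)) => [/eqP se|ne]; last first.
  have -> : patterns e s = 0 by apply/eqP; apply: contraNT ne => /patterns_count ->.
  have -> : patterns (e + p + p) (cap p s) = 0.
    by apply/eqP; apply: contraNT ne => /patterns_count /capcount ->.
  by rewrite !muln0.
have sf : count id (neg s) = f by have := count_neg s; lia.
have := spread_cap_pair (p := p) (s := s) (w := w).
rewrite ss => /(_ wE).
rewrite -(patterns_spread se) -(patterns_spread sf).
rewrite -(patterns_spread ((capcount _ _).2 se)) -(patterns_spread ((capcount _ _).2 sf)).
by move=> E; rewrite -[RHS]mulnA; move: E; lia.
Qed.

(** * Evaluation of a word of transfer operators *)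

Lemma down_white_iter_up_black j G x :
  down_white (iter j up_black G) x = 2 ^ j * iter j up_black (down_white G) x.
Proof.
elim: j x => [|j IH] x; first by rewrite mul1n.
by rewrite iterS down_white_up_black (eq_up_black IH) up_blackZ expnS mulnA.
Qed.

Lemma sum_ord_recr (p : pred nat) (F : nat -> nat) n :
  \sum_(m < n.+1 | p m) F m = \sum_(m < n | p m) F m + (if p n then F n else 0).
Proof. by rewrite [LHS]big_mkcond [in RHS]big_mkcond big_ord_recr. Qed.

Lemma sum_ord_recl (p : pred nat) (F : nat -> nat) n :
  \sum_(m < n.+1 | p m) F m =
  (if p 0 then F 0 else 0) + \sum_(m < n | p m.+1) F m.+1.
Proof.
by rewrite [LHS]big_mkcond [in RHS]big_mkcond big_ord_recl.
Qed.

Section Evolution.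
Variables (W : nat -> nat) (b : nat -> bool) (T : nat -> bitseq -> nat).

(** [W n] stands for the width at the n-th diagonal, [b n] says whether the row left there is black,
    and [T n] counts completions. Outside the middle part black rows narrow the region and white
    rows widen it; in the middle part it is the reverse. *)
Definition outer_step (n : nat) : Prop :=
  if b n then W n = (W n.+1).+1 /\
    (forall P, size P = W n -> T n P = up_black (T n.+1) P)
  else W n.+1 = (W n).+1 /\
    (forall P, size P = W n -> T n P = down_white (T n.+1) P).

Definition inner_step (n : nat) : Prop :=
  if b n then W n.+1 = (W n).+1 /\
    (forall P, size P = W n -> T n P = down_black (T n.+1) P)
  else W n = (W n.+1).+1 /\
    (forall P, size P = W n -> T n P = up_white (T n.+1) P).

Lemma pairingC n F G : pairing n F G = pairing n G F.
Proof. by apply: eq_bigr => x _; rewrite mulnC. Qed.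

Lemma pairingZl n c F G : pairing n (fun x => c * F x) G = c * pairing n F G.
Proof. by rewrite /pairing big_distrr; apply: eq_bigr => x _; rewrite /= mulnA. Qed.

Lemma pairing_patterns0 n G : pairing n (patterns 0) G = G (nseq n false).
Proof.
elim: n G => [|n IH] G; first by rewrite /pairing big_bits0 mul1n.
rewrite /pairing big_bitsS big1 ?add0n //.
exact: (IH (fun y => G (false :: y))).
Qed.

(** By adjointness the rows act on a weight that starts as the empty configuration: a white row adds
    an interlacing, a black one only a factor [2 ^ k]. The second equation gives the exponent
    through the widths, without subtraction. *)
Lemma upper_evolution n : (forall m, m < n -> outer_step m) ->
  let k := \sum_(m < n) ~~ b m in
  exists2 E, T 0 (nseq (W 0) false) = 2 ^ E * pairing (W n) (patterns k) (T n)
    & \sum_(m < n | ~~ b m) W m.+1 + 'C(k, 2) = E + W n * k.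
Proof.
elim: n => [|n IH] steps /=.
  by exists 0; rewrite !big_ord0 ?mul1n ?muln0 // pairing_patterns0.
have {IH} [|E TE CE] := IH; first by move=> m mn; apply: steps; rewrite ltnW.
rewrite (sum_ord_recr (fun m => ~~ b m) (fun m => W m.+1)) big_ord_recr /=.
move: TE CE; set k := \sum_(m < n) _; set C := \sum_(m < n | _) _ => TE CE.
have := steps n (ltnSn n); rewrite /outer_step.
case: (b n) => -[WE Tn] /=; rewrite ?addn0 ?addn1.
  exists (E + k); last by move: CE; rewrite WE; lia.
  rewrite TE (eq_pairing (F' := patterns k) (G' := up_black (T n.+1))) //.
  rewrite WE pairingC pairing_up_black pairingC.
  rewrite (eq_pairing (F' := fun x => 2 ^ k * patterns k x) (G' := T n.+1)) //.
    by rewrite pairingZl expnD mulnA.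
  by move=> x _; rewrite down_black_patterns.
exists E; last by move: CE; rewrite WE binS bin1; lia.
rewrite TE (eq_pairing (F' := patterns k) (G' := down_white (T n.+1))) //.
by rewrite WE -pairing_up_white.
Qed.

(** Adjointness carries every row over to [F]. A white row met after [j] black ones is moved inside
    them at the cost of [2 ^ j], so that the interlacings act first. *)
Lemma inner_evolution F n : (forall m, m < n -> inner_step m) ->
  let j := \sum_(m < n) b m in let q := \sum_(m < n) ~~ b m in
  W n + q = W 0 + j /\
  exists2 E, pairing (W 0) F (T 0) =
      2 ^ E * pairing (W n) (iter j up_black (iter q down_white F)) (T n)
    & \sum_(m < n | b m) W m.+1 + j * q = E + j * W 0 + 'C(j.+1, 2).
Proof.
elim: n => [|n IH] steps /=.
  by rewrite !big_ord0; split=> //; exists 0; rewrite ?mul1n.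
have {IH} [|WE [E TE CE]] := IH; first by move=> m mn; apply: steps; rewrite ltnW.
rewrite (sum_ord_recr b (fun m => W m.+1)) !big_ord_recr /=.
move: WE TE CE; set q := \sum_(m < n) ~~ b m; set j := \sum_(m < n) b m.
set C := \sum_(m < n | _) _ => WE TE CE.
have := steps n (ltnSn n); rewrite /inner_step.
case: (b n) => -[WS Tn] /=; rewrite ?addn0 ?addn1.
  split; first by lia.
  exists E; last by rewrite binS bin1; move: CE; lia.
  rewrite TE WS pairing_up_black.
  by congr (_ * _); apply: eq_pairing.
split; first by lia.
exists (E + j); last by move: CE; lia.
rewrite TE expnD -mulnA; congr (_ * _).
rewrite (eq_pairing (F' := iter j up_black (iter q down_white F)) (G' := up_white (T n.+1))) //.
rewrite WS pairingC pairing_up_white pairingC -pairingZl.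
by apply: eq_pairing => // x _; rewrite down_white_iter_up_black.
Qed.

End Evolution.

(** Holes take the part of particles: none may remain at the bottom, each black row adds an
    interlacing of holes, and each white row a factor [2 ^ k]. *)
Lemma lower_evolution n W b T : (forall m, m < n -> outer_step W b T m) ->
  (forall P, size P = W n -> T n P = all id P) ->
  let k := \sum_(m < n) b m in
  exists2 E, forall P, size P = W 0 -> T 0 P = 2 ^ E * patterns k (neg P)
    & \sum_(m < n | b m) W m + 'C(k, 2) = E + W 0 * k.
Proof.
elim: n W b T => [|n IH] W b T steps Tend /=.
  exists 0; rewrite !big_ord0 ?muln0 // => P /Tend ->.
  rewrite mul1n /= /neg all_map; congr (nat_of_bool _).
  by apply: eq_all => c /=; rewrite negbK.
have := IH (fun m => W m.+1) (fun m => b m.+1) (fun m => T m.+1).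
case=> [m mn||E TE CE]; [exact: (steps m.+1)|exact: Tend|].
rewrite (sum_ord_recl b W) big_ord_recl /=.
move: TE CE; rewrite /bump /=; set k := \sum_(m < n) _; set C := \sum_(m < n | _) _ => TE CE.
have := steps 0 isT; rewrite /outer_step.
case: (b 0) => -[WS Tn] /=; rewrite ?add0n ?add1n.
  exists E; last by move: CE; rewrite WS binS bin1; lia.
  move=> P sP; rewrite (Tn P sP) -up_whiteZ -up_white_neg.
  apply: eq_big_seq => y /size_bits sy; rewrite /= TE ?negK //.
  by rewrite size_neg sy size_neg sP WS.
exists (E + k); last by move: CE; rewrite WS; lia.
move=> P sP; rewrite (Tn P sP) expnD -mulnA -down_white_patterns_neg -down_whiteZ.
by apply: eq_big_seq => y /size_bits sy; rewrite TE // sy sP WS.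
Qed.

Lemma iter_pairing_up_black p n F G :
  pairing (n + p) (iter p up_black F) G = pairing n F (iter p down_black G).
Proof.
elim: p n G => [|p IH] n G; first by rewrite addn0.
by rewrite addnS iterS pairing_up_black IH -iterSr.
Qed.

Lemma iter_down_black_neg p F x :
  iter p down_black (F \o neg) x = iter p down_white F (neg x).
Proof.
elim: p x => //= p IH x.
by rewrite -down_black_neg negK; apply: eq_down_black => y; rewrite IH.
Qed.

(** * Products of factorials and the closed formula *)

Lemma prod_pred_fact m n : m <= n ->
  (\prod_(m.+1 <= i < n.+1) (i.-1)`!) * superfact m = superfact n.
Proof.
rewrite /superfact => mn; rewrite big_add1 -!(big_mkord xpredT (fun i => i`!)).
by rewrite mulnC -big_cat_nat.
Qed.

Lemma superfactD p m :
  superfact (p + m) = superfact p * \prod_(i < m) (p + i)`!.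
Proof. by rewrite /superfact big_split_ord. Qed.

(** Both factors run through the factorials of p, ..., w - 1, the second in decreasing order. *)
Lemma prod_fact_pair p w : p <= w ->
  (\prod_(1 <= i < (w - p).+1) ((p + i).-1`! * (w - i)`!)) * superfact p ^ 2 =
  superfact w ^ 2.
Proof.
move=> pw; rewrite big_add1 big_mkord big_split -mulnn mulnACA /=.
have -> : superfact w = superfact (p + (w - p)) by rewrite subnKC.
rewrite superfactD -mulnn ![_ * superfact p]mulnC; congr (_ * _); congr (_ * _).
  by apply: eq_bigr => i _; rewrite addnS.
rewrite (reindex_inj rev_ord_inj) /=.
by apply: eq_bigr => i _; congr (_`!); have := ltn_ord i; lia.
Qed.

(** The quotient is the exact sum w + (w - 1) + ... + (w - h + 1). *)
Lemma half_row_sum h w : h <= w ->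
  (h * (2 * w - h + 1)) %/ 2 + 'C(h, 2) = h * w.
Proof.
move=> hw.
have C2 : 'C(h, 2) * 2 = h * h.-1 by rewrite (bin_ffact h 2) ffactnS ffactn1.
have -> : h * (2 * w - h + 1) = (h * w - 'C(h, 2)) * 2.
  by case: h hw C2 => [|h] hw C2; rewrite ?mul0n // mulnBl C2 /=; nia.
by rewrite mulnK // subnK //; case: h hw C2 => [|h] hw C2 //=; nia.
Qed.

Lemma bin2D A B : 'C(A + B, 2) = 'C(A, 2) + 'C(B, 2) + A * B.
Proof. by elim: A => [|A IH]; rewrite ?addn0 // addSn !binS !bin1 IH mulSn; lia. Qed.

Local Open Scope ring_scope.

(** The evaluation is separated from the geometry: the region enters only through its widths, the
    colours of its rows, the step equations and the end condition. *)
Theorem transfer_count (W : nat -> nat) (b : nat -> bool)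
    (T : nat -> bitseq -> nat) (n1 n2 n3 w : nat) :
  (forall m, (m < n1)%N -> outer_step W b T m) ->
  (forall m, (m < n2)%N -> inner_step W b T (n1 + m)) ->
  (forall m, (m < n3)%N -> outer_step W b T (n1 + n2 + m)) ->
  (forall P, size P = W (n1 + n2 + n3)%N -> T (n1 + n2 + n3)%N P = all id P) ->
  W n1 = w -> W (n1 + n2)%N = w ->
  let Z := T 0%N (nseq (W 0%N) false) in
  let h1 := (\sum_(m < n1) ~~ b m)%N in
  let h2 := (\sum_(m < n2) b (n1 + m))%N in
  let h3 := (\sum_(m < n3) b (n1 + n2 + m))%N in
  let C1 := (\sum_(m < n1 | ~~ b m) W m.+1)%N in
  let C2 := (\sum_(m < n2 | b (n1 + m)%N) W (n1 + m).+1)%N in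
  let C3 := (\sum_(m < n3 | b (n1 + n2 + m)%N) W (n1 + n2 + m))%N in
  (h1 < w)%N -> (h2 < w)%N -> (h3 < w)%N ->
  ((h1 + h3)%N <> (w + h2)%N -> Z = 0%N)
  /\
  ((h1 + h3)%N = (w + h2)%N ->
    Z%:R =
      (2 : rat) ^ ((C1 + C2 + C3)%:Z
                   - ((h1 * (2 * w - h1 + 1)) %/ 2)%:Z
                   - ((h2 * (2 * w - h2 + 1)) %/ 2)%:Z
                   - ((h3 * (2 * w - h3 + 1)) %/ 2)%:Z)
      * (2 : rat) ^ ('C(h1 + 2 * h2 + h3, 2)%:Z
                     - (2 * h2 * (w + h2))%:Z
                     - 'C(h1 + h2, 2)%:Z
                     - 'C(h2 + h3, 2)%:Z)
      * (((\prod_((h2 + h3).+1 <= i < (h2 + w).+1) (i.-1)`!)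
          * (\prod_((h1 + h2).+1 <= i < (h2 + w).+1) (i.-1)`!)
          * (\prod_(1 <= i < (w - h3).+1) (i.-1)`!)
          * (\prod_(1 <= i < (w - h1).+1) (i.-1)`!))%N%:R
         / (\prod_(1 <= i < (w - h2).+1) ((h2 + i).-1`! * (w - i)`!))%N%:R)).
Proof.
move=> st1 st2 st3 Tend Ww Ww' Z h1 h2 h3 C1 C2 C3 h1w h2w h3w.
have [E1 ZE CE1] := upper_evolution st1.
rewrite -/Z -/h1 -/C1 Ww in ZE CE1.
have [] := @inner_evolution (fun m => W (n1 + m)%N) (fun m => b (n1 + m)%N)
  (fun m => T (n1 + m)%N) (patterns h1) n2.
  move=> m mn; have := st2 m mn; rewrite /inner_step /= !addnS //.
rewrite -/h2 addn0 Ww Ww' => /addnI -> [E2 ZE2 CE2].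
have {}CE2 : (C2 + h2 * h2 = E2 + h2 * w + 'C(h2.+1, 2))%N.
  by rewrite -CE2; congr (_ + _)%N; apply: eq_bigr => m _; rewrite addnS.
have [] := @lower_evolution n3 (fun m => W (n1 + n2 + m)%N)
  (fun m => b (n1 + n2 + m)%N) (fun m => T (n1 + n2 + m)%N).
- by move=> m mn; have := st3 m mn; rewrite /outer_step /= !addnS.
- exact: Tend.
rewrite -/h3 -/C3 addn0 Ww' => E3 TE CE3.
(* The [h2] moves pass by adjointness to the lower part, which shortens the configurations to length
   w - h2; on holes they are interlacings, so both factors are capped. *)
have {TE ZE ZE2} ZE : Z = (2 ^ (E1 + E2 + E3) * \sum_(s <- bits (w - h2))
    patterns (h1 + h2) (cap h2 s) * patterns (h3 + h2) (cap h2 (neg s)))%N.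
  rewrite ZE ZE2 !expnD -!mulnA; congr (_ * (_ * _))%N.
  rewrite (eq_pairing (F' := iter h2 up_black (iter h2 down_white (patterns h1)))
    (G' := fun P => 2 ^ E3 * (patterns h3 \o neg) P)%N) => [|//|P sP]; last first.
    by rewrite TE ?addn0 ?Ww'.
  rewrite pairingC pairingZl pairingC; congr (_ * _)%N.
  rewrite -[w in pairing w](subnK (ltnW h2w)) iter_pairing_up_black.
  apply: eq_bigr => s _.
  by rewrite iter_down_white_patterns iter_down_black_neg iter_down_white_patterns.
split=> [ne|eq13].
  (* In a nonzero term [s] has h1 - h2 true and h3 - h2 false bits, w - h2 in all, which gives the
     excluded equality. *)
  rewrite ZE big1_seq ?muln0 // => s /= /size_bits ss.
  apply/eqP; apply: contra_notT ne; rewrite muln_eq0 negb_or.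
  case/andP=> /patterns_count + /patterns_count; have := count_neg s.
  by rewrite /cap !count_cat !count_nseq /=; lia.
have [ehw fhw] : h1 = (w - h3 + h2)%N /\ h3 = (w - h1 + h2)%N by lia.
have wE : (w = w - h3 + (w - h1) + h2)%N by lia.
have := patterns_pair_sum wE.
have -> : (w - h3 + (w - h1) = w - h2)%N by lia.
rewrite -ehw -fhw; move: ZE; set S := (\sum_(s <- _) _)%N => ZE SE.
have le1 : (h2 + h3 <= h2 + w)%N by lia.
have le2 : (h1 + h2 <= h2 + w)%N by lia.
have E3' := prod_pred_fact (leq0n (w - h3)).
have E4' := prod_pred_fact (leq0n (w - h1)).
have sf0 : superfact 0 = 1%N by rewrite /superfact big_ord0.
rewrite sf0 muln1 in E3'; rewrite sf0 muln1 in E4'.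
move: (prod_fact_pair (ltnW h2w)) (prod_pred_fact le1) (prod_pred_fact le2).
rewrite E3' E4'.
set P5 := (\prod_(1 <= i < _) _)%N; set P1 := (\prod_(_ <= i < _) _)%N.
set P2 := (\prod_(_ <= i < _) _)%N => E5 E1' E2'.
have {SE} SP : (S * P5 = 2 ^ ((w - h3) * (w - h1)) *
    (P1 * P2 * superfact (w - h3) * superfact (w - h1)))%N.
  have pos : (0 < superfact (h1 + h2) * superfact (h3 + h2) * superfact h2 ^ 2)%N.
    by rewrite !muln_gt0 ?expn_gt0 !superfact_gt0.
  apply/eqP; rewrite -(eqn_pmul2r pos); apply/eqP.
  transitivity (S * (superfact (h1 + h2) * superfact (h3 + h2) * superfact w ^ 2))%N.
    by rewrite -E5; ring.
  rewrite SE -[in LHS]mulnn [(w + h2)%N]addnC -{1}E1' -E2' [(h3 + h2)%N]addnC.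
  by ring.
have P5n0 : P5%:R != 0 :> rat.
  rewrite pnatr_eq0; apply/eqP => P50.
  have := superfact_gt0 w; rewrite -sqrn_gt0 -E5 P50 //.
(* The three exponent relations add up; for the middle part C(h2 + 1, 2) + C(h2, 2) = h2^2 is
   needed. *)
have -> : (C1 + C2 + C3)%:Z - ((h1 * (2 * w - h1 + 1)) %/ 2)%:Z
   - ((h2 * (2 * w - h2 + 1)) %/ 2)%:Z - ((h3 * (2 * w - h3 + 1)) %/ 2)%:Z
   = (E1 + E2 + E3)%N%:Z.
  have := half_row_sum (ltnW h1w); have := half_row_sum (ltnW h2w).
  have := half_row_sum (ltnW h3w).
  have : ('C(h2.+1, 2) + 'C(h2, 2) = h2 * h2)%N.
    by rewrite binS bin1 -addnA addnC; elim: (h2) => [|h IH] //; rewrite binS bin1; lia.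
  move: CE1 CE2 CE3.
  by rewrite [(w * h1)%N]mulnC [(w * h3)%N]mulnC; lia.
(* The binomials leave (h1 + h2)(h2 + h3) - 2 h2 (w + h2). With e = w - h3 and f = w - h1 this is (e
   + 2 h2)(f + 2 h2) - 2 h2 (e + f + 2 h2) = e f. *)
have -> : 'C(h1 + 2 * h2 + h3, 2)%:Z - (2 * h2 * (w + h2))%:Z - 'C(h1 + h2, 2)%:Z
    - 'C(h2 + h3, 2)%:Z = ((w - h3) * (w - h1))%N%:Z.
  rewrite (_ : h1 + 2 * h2 + h3 = (h1 + h2) + (h2 + h3))%N ?bin2D; last by lia.
  nia.
rewrite ZE natrM natrX -mulrA -!exprnP; congr (_ * _).
apply: (mulIf P5n0); rewrite mulrA divfK // -natrM SP natrM natrX.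
by [].
Qed.

Local Close Scope ring_scope.

(** * Matchings of rows of cells *)

Section Matchings.
Variables (C : choiceType) (adj : rel C) (r : seq C).
Hypothesis adjC : symmetric adj.
Hypothesis adj_irr : irreflexive adj.
Implicit Types (s : seq C) (X : {set seq_sub r}).

Definition domino (t : {set seq_sub r}) : bool :=
  [exists u : seq_sub r, exists v : seq_sub r,
     (t == [set u; v]) && adj (val u) (val v)].

Definition domino_tilings X : {set {set {set seq_sub r}}} :=
  [set P : {set {set seq_sub r}} | partition P X && [forall t in P, domino t]].

Lemma domino_tilings0 : #|domino_tilings set0| = 1.
Proof.
rewrite (_ : domino_tilings set0 = [set set0]) ?cards1 //.
apply/setP => P; rewrite !inE partition_set0.
by case: eqP => //= ->; apply/forall_inP => t; rewrite inE.
Qed.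

Lemma card_tilings_with X (t : {set seq_sub r}) : t \subset X -> domino t ->
  #|[set P in domino_tilings X | t \in P]| = #|domino_tilings (X :\: t)|.
Proof.
move=> tX dt.
have t0 : t != set0.
  case/existsP: (dt) => u /existsP[v /andP[/eqP-> _]].
  by apply/set0Pn; exists u; rewrite !inE eqxx.
have tnot Q : Q \in domino_tilings (X :\: t) -> t \notin Q.
  rewrite inE => /andP[Qp _]; apply: contraTN (Qp) => tQ.
  apply/negP => {}Qp; case/set0Pn: t0 => x xt.
  have : x \in cover Q by apply/bigcupP; exists t.
  by rewrite (cover_partition Qp) inE xt.
rewrite -[RHS](card_in_imset (f := fun Q : {set {set seq_sub r}} => t |: Q)); last first.
  move=> Q Q' QX Q'X E.
  by rewrite -(setU1K (tnot _ QX)) E (setU1K (tnot _ Q'X)).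
apply: eq_card => P; rewrite !inE; apply/idP/imsetP.
  case/andP => /andP[Pp /forall_inP Pd] tP.
  exists (P :\ t); last by rewrite setD1K.
  rewrite inE partitionD1 //=; apply/forall_inP => t'.
  by rewrite !inE => /andP[_ /Pd].
case=> Q QX ->; rewrite setU11 andbT.
move: QX; rewrite inE => /andP[Qp /forall_inP Qd].
apply/andP; split; last first.
  by apply/forall_inP => t'; rewrite !inE => /orP[/eqP->|/Qd].
have -> : X = t :|: (X :\: t) by rewrite setDE setUIr setUCr setIT (setUidPr tX).
apply: partitionU1 => //; rewrite disjoint_sym disjoints_subset.
by rewrite setDE subsetIr.
Qed.

Lemma pair_inj (T : finType) (x y z : T) : [set x; y] = [set x; z] -> y = z.
Proof.
move=> E; have : y \in [set x; z] by rewrite -E !inE eqxx orbT.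
have : z \in [set x; y] by rewrite E !inE eqxx orbT.
by rewrite !inE => /orP[/eqP->|/eqP-> //] /orP[/eqP->|/eqP->].
Qed.

(** Exactly one block of a tiling contains [v], and the tilings are sorted by the partner of [v] in
    it. *)
Lemma card_tilings_peel X v : v \in X ->
  #|domino_tilings X| =
  \sum_(u in X | adj (val v) (val u)) #|domino_tilings (X :\: [set v; u])|.
Proof.
move=> vX; rewrite -sum1_card.
have one P : P \in domino_tilings X ->
    \sum_(u in X | adj (val v) (val u)) ([set v; u] \in P) = 1.
  rewrite inE => /andP[Pp /forall_inP Pd].
  have vc : v \in cover P by rewrite (cover_partition Pp).
  have tP : pblock P v \in P by rewrite pblock_mem.
  have [u [tE avu]] : exists u, pblock P v = [set v; u] /\ adj (val v) (val u).
    have : v \in pblock P v by rewrite mem_pblock.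
    case/existsP: (Pd _ tP) => x /existsP[y /andP[/eqP-> xy]].
    rewrite !inE => /orP[] /eqP->; first by exists y.
    by exists x; rewrite setUC adjC.
  have uX : u \in X.
    rewrite -(cover_partition Pp); apply/bigcupP; exists (pblock P v) => //.
    by rewrite tE !inE eqxx orbT.
  rewrite (bigD1 u) /= ?uX // -tE tP big1 // => u' /andP[_ uu'].
  apply/eqP; rewrite eqb0; apply: contra uu' => u'P; apply/eqP.
  apply: (@pair_inj _ v); rewrite -tE; apply/esym/def_pblock => //.
    by case/and3P: Pp.
  by rewrite !inE eqxx.
rewrite -(eq_bigr _ one) exchange_big /=; apply: eq_bigr => u /andP[uX avu].
rewrite -card_tilings_with.
- rewrite -sum1_card big_mkcond [RHS]big_mkcond /=; apply: eq_bigr => P _.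
  by rewrite [in RHS]inE; case: (P \in domino_tilings X); case: (_ \in P).
- by apply/subsetP => x; rewrite !inE => /orP[]/eqP->.
- by apply/existsP; exists v; apply/existsP; exists u; rewrite eqxx.
Qed.

(** The ambient list [r] stays fixed while cells are removed, so that all tilings live in one finite
    type. *)
Definition matchings s : nat := #|domino_tilings [set x | val x \in s]|.

Lemma eq_matchings s s' : s =i s' -> matchings s = matchings s'.
Proof.
move=> ss; congr #|domino_tilings _|.
by apply/setP => x; rewrite !inE ss.
Qed.

Lemma matchings_nil : matchings [::] = 1.
Proof.
by rewrite -domino_tilings0; congr #|domino_tilings _|.
Qed.

Lemma matchings_peel v s nb : {subset v :: s <= r} -> uniq (v :: s) -> uniq nb ->
  {subset nb <= s} -> {in s, forall x, adj v x = (x \in nb)} ->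
  matchings (v :: s) = \sum_(u <- nb) matchings [seq x <- s | x != u].
Proof.
move=> sr /= /andP[vs us] unb nbs nbP.
have vr : v \in r by apply: sr; rewrite inE eqxx.
pose v' : seq_sub r := SeqSub vr.
rewrite /matchings (@card_tilings_peel _ v') ?inE ?eqxx //.
have nbr : {subset nb <= r} by move=> x /nbs xs; apply: sr; rewrite inE xs orbT.
have -> : nb = [seq val x | x <- pmap insub nb : seq (seq_sub r)].
  rewrite (pmap_filter (insubK _)); apply/esym/all_filterP/allP => x /nbr xr.
  by rewrite insubT.
rewrite big_map big_uniq /= ?pmap_sub_uniq //.
apply: eq_big => [x|x].
  rewrite mem_pmap_sub !inE; case: (val x =P v) => [xv|xv] /=.
    by rewrite xv adj_irr; apply/esym/negP => /nbs; rewrite (negbTE vs).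
  case: (boolP (val x \in s)) => xs; first by rewrite nbP.
  by apply/esym/negP => /nbs; rewrite (negbTE xs).
move=> /andP[_ vx]; congr #|domino_tilings _|; apply/setP => y.
rewrite !inE mem_filter -!val_eqE /=.
case: (val y =P v) => [->|_] /=; last by rewrite andbC.
by rewrite (negbTE vs) andbF.
Qed.

Lemma perm_matchings s s' : perm_eq s s' -> matchings s = matchings s'.
Proof. by move=> ss; apply/eq_matchings/perm_mem. Qed.

Lemma matchings_peel0 v s : {subset v :: s <= r} -> uniq (v :: s) ->
  {in s, forall x, adj v x = false} -> matchings (v :: s) = 0.
Proof.
by move=> sr us vP; rewrite (matchings_peel (nb := [::])) ?big_nil.
Qed.

Lemma filter_neq_head u s : u \notin s -> [seq x <- s | x != u] = s.
Proof.
by move=> us; apply/all_filterP/allP => x xs; apply: contraNneq us => <-.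
Qed.

Lemma matchings_peel1 v u s : {subset v :: u :: s <= r} -> uniq (v :: u :: s) ->
  {in u :: s, forall x, adj v x = (x == u)} ->
  matchings (v :: u :: s) = matchings s.
Proof.
move=> sr us vP; rewrite (matchings_peel (nb := [:: u])) //.
- rewrite big_seq1 /= eqxx /= filter_neq_head //.
  by case/and3P: us.
- by move=> x; rewrite !inE => ->.
- by move=> x xs; rewrite vP // inE.
Qed.

Lemma matchings_peel2 v u w s : {subset [:: v, u, w & s] <= r} ->
  uniq [:: v, u, w & s] ->
  {in [:: u, w & s], forall x, adj v x = (x \in [:: u; w])} ->
  matchings [:: v, u, w & s] = matchings (w :: s) + matchings (u :: s).
Proof.
move=> sr un vP; move: (un) => /= /and4P[_ + us _].
rewrite inE negb_or => /andP[uw us'].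
have wu : w != u by rewrite eq_sym.
rewrite (matchings_peel (nb := [:: u; w])) //= ?inE ?uw //.
  by rewrite big_cons big_seq1 /= !eqxx /= wu uw !filter_neq_head.
by move=> x; rewrite !inE => /orP[]->; rewrite ?orbT.
Qed.

(* The i-th vertex of us has no other neighbours in S than the i-th and the
   (i+1)-st vertices of ws, as far as these exist. *)
Fixpoint linked (us ws S : seq C) : Prop :=
  if us is u :: us' then
    {in S, forall x, adj u x = (x \in take 2 ws)} /\ linked us' (behead ws) S
  else True.

Lemma sub_linked us ws S S' : {subset S' <= S} ->
  linked us ws S -> linked us ws S'.
Proof.
move=> SS; elim: us ws => //= u us IH ws [uP usP].
by split; [move=> x /SS /uP | apply: IH].
Qed.

Lemma mask_subset (T : eqType) m (s : seq T) : {subset mask m s <= s}.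
Proof. by move=> x /mem_mask. Qed.

Ltac perm_by_count :=
  apply/permP => ?; do 4 (rewrite ?(count_cat, count_nseq) /=); lia.

Local Arguments bits : simpl never.

(* Whether the path w_0 u_0 w_1 u_1 ..., restricted to the true bits of D (for
   the u_i) and of A (for the w_i), has a perfect matching when w_0 is already
   matched from outside iff p holds. *)
Fixpoint row_kernel (p : bool) (D A : bitseq) : bool :=
  match D, A with
  | d :: D', a :: A' =>
      if a == p then row_kernel d D' A' else [&& d, ~~ p & row_kernel false D' A']
  | [::], [::] => ~~ p
  | [::], [:: a] => a == p
  | _, _ => false
  end.

(** The cells of [us] are peeled from the left. [avail] tells whether the first cell of [ws] is
    still free, [A] marks the cells of [ws] matched with the row [us] (including one taken
    beforehand), and cells left over join [Y]. *)
Lemma matchings_row us ws D (avail : bool) Y :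
  let S := us ++ ws ++ Y in
  {subset S <= r} -> uniq S -> linked us ws S ->
  size D = size us -> size us <= size ws <= (size us).+1 -> avail || (ws != [::]) ->
  matchings (mask D us ++ (if avail then ws else behead ws) ++ Y) =
  \sum_(A <- bits (size ws))
    row_kernel (~~ avail) D A * matchings (mask (neg A) ws ++ Y).
Proof.
elim: us ws D avail Y => [|u us IH] [|w ws] [|d D] avail Y //=.
- by case: avail => // _ _ _ _ _ _; rewrite big_bits0 mul1n.
- case: ws => // _ _ _ _ _ _; rewrite big_bitsS !big_bits0.
  by case: avail; rewrite /= ?mul1n ?addn0.
move=> Sr Su [uP usP] [sD] sw _.
pose rest := us ++ ws ++ Y.
have Sp : perm_eq (u :: us ++ w :: ws ++ Y) (u :: w :: rest).
  by rewrite /rest; perm_by_count.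
have ur : uniq (u :: w :: rest) by rewrite -(perm_uniq Sp).
have rr : {subset u :: w :: rest <= r} by move=> x; rewrite -(perm_mem Sp) => /Sr.
have Sur : {subset u :: w :: rest <= u :: us ++ w :: ws ++ Y}.
  by move=> x; rewrite (perm_mem Sp).
(* [c] tells whether [w] is left over and joins [Y]. *)
have IH' (av c : bool) : av || (ws != [::]) ->
  matchings (mask D us ++ (if av then ws else behead ws) ++ nseq c w ++ Y) =
  \sum_(A <- bits (size ws))
    row_kernel (~~ av) D A * matchings (mask (neg A) ws ++ nseq c w ++ Y).
  move=> avw.
  have pE : perm_eq (us ++ ws ++ nseq c w ++ Y) (nseq c w ++ rest).
    by rewrite /rest; perm_by_count.
  have sub : {subset us ++ ws ++ nseq c w ++ Y <= u :: us ++ w :: ws ++ Y}.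
    move=> x; rewrite (perm_mem pE) => xr; apply: Sur; move: xr.
    by case: (c); rewrite /= ?inE => ->; rewrite ?orbT.
  apply: IH => //.
  - by move=> x /sub /Sr.
  - rewrite (perm_uniq pE); case/andP: ur => _.
    by case: (c) => //= /andP[].
  - exact: sub_linked usP.
have sub1 (c : bool) (M := u :: nseq c w ++ mask D us ++ ws ++ Y) :
    {subset M <= u :: w :: rest} /\ uniq M.
  have sM : subseq M (u :: w :: rest).
    have sr : subseq (mask D us ++ ws ++ Y) rest.
      by apply: cat_subseq => //; apply: mask_subseq.
    rewrite /M /= eqxx; case: (c) => /=; rewrite ?eqxx //.
    exact: subseq_trans sr (subseq_cons _ _).
  by split; [exact: mem_subseq sM | apply: subseq_uniq sM ur].
have sub2 (c : bool) (M := u :: nseq c w ++ mask D us ++ ws ++ Y) :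
    {subset M <= r} by have [sM _] := sub1 c => x /sM /rr.
have sub3 (c : bool) (M := nseq c w ++ mask D us ++ ws ++ Y) :
    {in M, forall x, adj u x = (x \in w :: take 1 ws)}.
  have [sM _] := sub1 c => x xM; apply: uP; apply: Sur; apply: sM.
  by rewrite inE xM orbT.
have sub4 x : x \in mask D us ++ ws ++ Y -> (x == w) = false.
  move=> xM; apply/negP => /eqP xw; case/and3P: ur => _ + _; rewrite -xw /rest => /negP[].
  by move: xM; rewrite !mem_cat => /or3P[/mask_subset->|->|->]; rewrite ?orbT.
rewrite big_bitsS; case: d => /=.
  case: ws sw rest Sp ur rr Sur {IH Sr Su uP usP} IH' sub1 sub2 sub3 sub4 =>
    [|v vs] sw rest Sp ur rr Sur IH' sub1 sub2 sub3 sub4.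
    case: us D sD sw rest Sp ur rr Sur IH' sub1 sub2 sub3 sub4 =>
      [|//] [|//] _ _ rest Sp ur rr Sur _ sub1 sub2 sub3 sub4.
    rewrite !big_bits0; case: avail => /=.
      rewrite mul1n addn0; apply: matchings_peel1.
      + exact: (sub2 true).
      + exact: (sub1 true).2.
      + by move=> x xM; rewrite (sub3 true) //= inE.
    rewrite !mul0n; apply: matchings_peel0; first exact: (sub2 false).
      exact: (sub1 false).2.
    by move=> x xM; rewrite (sub3 false) //= inE sub4.
  case: avail => /=.
    (* Here [u] is matched with [w], or with the next cell [v], in which case [w] is left over. *)
    rewrite (@perm_matchings _ [:: u, w, v & mask D us ++ vs ++ Y]); last first.
      by perm_by_count.
    have pE : perm_eq [:: u, w, v & mask D us ++ vs ++ Y]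
        (u :: nseq true w ++ mask D us ++ (v :: vs) ++ Y) by perm_by_count.
    rewrite matchings_peel2.
    + have IHf := IH' false true isT; have IHt := IH' true false isT.
      rewrite /= in IHf IHt; congr (_ + _).
        by rewrite -IHt; apply: perm_matchings; perm_by_count.
      rewrite (@perm_matchings _ (mask D us ++ vs ++ w :: Y)) ?IHf; last first.
        by perm_by_count.
      apply: eq_bigr => A _; congr (_ * _).
      by apply: perm_matchings; perm_by_count.
    + by move=> x; rewrite (perm_mem pE) => /(sub2 true).
    + by rewrite (perm_uniq pE) (sub1 true).2.
    + move=> x xM; rewrite (sub3 true) /= ?take0 //.
      rewrite -(perm_mem (_ : perm_eq [:: w, v & mask D us ++ vs ++ Y] _)) //.
      by perm_by_count.
  rewrite [X in _ + X]big1 ?addn0 //.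
  have pE : perm_eq [:: u, v & mask D us ++ vs ++ Y]
        (u :: nseq false w ++ mask D us ++ (v :: vs) ++ Y) by perm_by_count.
  rewrite (@perm_matchings _ [:: u, v & mask D us ++ vs ++ Y]); last first.
    by perm_by_count.
  rewrite matchings_peel1.
  + exact: (IH' false false).
  + by move=> x; rewrite (perm_mem pE) => /(sub2 false).
  + by rewrite (perm_uniq pE) (sub1 false).2.
  + move=> x xM.
    have xM' : x \in mask D us ++ (v :: vs) ++ Y.
      rewrite -(perm_mem (_ : perm_eq [:: v & mask D us ++ vs ++ Y] _)) //.
      by perm_by_count.
    by rewrite (sub3 false) //= take0 !inE sub4.
case: avail => /=.
  rewrite [X in X + _]big1 ?add0n //.
  rewrite (@perm_matchings _ (mask D us ++ ws ++ w :: Y)); last by perm_by_count.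
  rewrite (IH' true true) //; apply: eq_bigr => A _; congr (_ * _).
  by apply: perm_matchings; perm_by_count.
by rewrite [X in _ + X]big1 ?addn0 //; apply: (IH' true false).
Qed.

Lemma row_kernel_up p D A : size A = (size D).+1 -> row_kernel p D A = zigzag p A D.
Proof.
elim: D A p => [|d D IH] [|a A] p //= => [|[sA]].
  by case: A => //= _; rewrite eq_sym.
by rewrite !IH //; case: p; case: a; case: d.
Qed.

(** The path now ends in the other row; without its first vertex it has both ends there, and the new
    first vertex is taken from outside exactly for [p (+) a]. *)
Lemma row_kernel_down p D a A : size D = (size A).+1 ->
  row_kernel p D (a :: A) = (p ==> a) && zigzag (p (+) a) D A.
Proof.
elim: A D p a => [|c A IH] [|d D] p a //= => [|] [sD].
  by case: D sD => //= _; case: p; case: a; case: d.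
by rewrite !IH //; case: p; case: a; case: d; case: c.
Qed.

Lemma matchings_zigzag_up us ws D Y :
  let S := us ++ ws ++ Y in
  {subset S <= r} -> uniq S -> linked us ws S ->
  size D = size us -> size ws = (size us).+1 ->
  matchings (mask D us ++ ws ++ Y) =
  \sum_(A <- bits (size ws)) matched A D * matchings (mask (neg A) ws ++ Y).
Proof.
move=> S Sr Su Sl sD sw; rewrite (@matchings_row us ws D true) ?sw ?leqnn ?leqnSn //.
by apply: eq_big_seq => A /size_bits sA; rewrite row_kernel_up // sA sD.
Qed.

(** The only neighbour of the leftmost cell [u] is [w]: if [u] is present it takes [w], otherwise
    [w] stays available, and [matchings_row] treats what remains. *)
Lemma matchings_zigzag_down u us w ws D Y :
  let S := u :: us ++ w :: ws ++ Y in
  {subset S <= r} -> uniq S -> {in S, forall x, adj u x = (x == w)} ->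
  linked us (w :: ws) S -> size D = size (u :: us) -> size us = size (w :: ws) ->
  matchings (mask D (u :: us) ++ w :: ws ++ Y) =
  \sum_(A <- bits (size (w :: ws)))
     matched D A * matchings (mask (neg A) (w :: ws) ++ Y).
Proof.
move=> S Sr Su uw Sl; case: D => //= d D [sD] sus.
have sub : {subset us ++ (w :: ws) ++ Y <= S}.
  by move=> x xS; rewrite inE xS orbT.
have row : matchings (mask D us ++ (if ~~ d then w :: ws else behead (w :: ws)) ++ Y) =
    \sum_(A <- bits (size (w :: ws)))
      row_kernel d D A * matchings (mask (neg A) (w :: ws) ++ Y).
  rewrite (@matchings_row us (w :: ws) D (~~ d) Y) ?negbK ?sD ?sus ?leqnn ?leqnSn ?orbT //.
  - by move=> x /sub /Sr.
  - by case/andP: Su.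
  - exact: sub_linked Sl.
transitivity (matchings (mask D us ++ (if ~~ d then w :: ws else behead (w :: ws)) ++ Y)).
  clear row; case: d => //=.
  have pE : perm_eq (u :: w :: us ++ ws ++ Y) S by rewrite /S; perm_by_count.
  have sM : subseq (u :: w :: mask D us ++ ws ++ Y) (u :: w :: us ++ ws ++ Y).
    rewrite /= !eqxx; apply: cat_subseq => //; exact: mask_subseq.
  rewrite (@perm_matchings _ [:: u, w & mask D us ++ ws ++ Y]); last first.
    by perm_by_count.
  apply: matchings_peel1.
  - by move=> x /(mem_subseq sM); rewrite (perm_mem pE) => /Sr.
  - by apply: subseq_uniq sM _; rewrite (perm_uniq pE).
  - move=> x xM; apply: uw; rewrite -(perm_mem pE); apply: (mem_subseq sM).
    by rewrite inE xM orbT.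
rewrite row; apply: eq_big_seq => -[|a A] /size_bits //= [sA].
by rewrite row_kernel_down ?sD ?sus /= ?sA //.
Qed.

(* Every upper triangle left over is matched to the lower triangle below it. *)
Lemma matchings_hypotenuses us vs A Y :
  let S := us ++ vs ++ Y in
  {subset S <= r} -> uniq S -> size us = size vs -> size A = size us ->
  (forall i x0, i < size us ->
     {in S, forall x, adj (nth x0 us i) x = (x == nth x0 vs i)}) ->
  matchings (mask (neg A) us ++ vs ++ Y) = matchings (mask A vs ++ Y).
Proof.
elim: us vs A Y => [|u us IH] [|v vs] [|a A] Y //= Sr Su [suv] [sA] uvP.
have pE : perm_eq (u :: v :: us ++ vs ++ Y) (u :: us ++ v :: vs ++ Y) by perm_by_count.
have un : uniq (u :: v :: us ++ vs ++ Y) by rewrite (perm_uniq pE).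
have IH' (c : bool) : matchings (mask (neg A) us ++ vs ++ nseq c v ++ Y) =
    matchings (mask A vs ++ nseq c v ++ Y).
  have qE : perm_eq (us ++ vs ++ nseq c v ++ Y) (nseq c v ++ us ++ vs ++ Y).
    by perm_by_count.
  have sub : {subset us ++ vs ++ nseq c v ++ Y <= u :: us ++ v :: vs ++ Y}.
    move=> x; rewrite (perm_mem qE) -(perm_mem pE) !inE mem_cat.
    by case: (c) => /=; rewrite ?inE => ->; rewrite ?orbT.
  apply: IH => //.
  - by move=> x /sub /Sr.
  - by rewrite (perm_uniq qE); case/andP: un => _; case: (c) => //= /andP[].
  - by move=> i x0 iu x /sub xS; rewrite (uvP i.+1).
case: a => /=; last first.
  have sM : subseq (u :: v :: mask (neg A) us ++ vs ++ Y) (u :: v :: us ++ vs ++ Y).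
    rewrite /= !eqxx; apply: cat_subseq => //; exact: mask_subseq.
  rewrite (@perm_matchings _ [:: u, v & mask (neg A) us ++ vs ++ Y]); last first.
    by perm_by_count.
  rewrite -(IH' false); apply: matchings_peel1.
  - by move=> x /(mem_subseq sM); rewrite (perm_mem pE) => /Sr.
  - exact: subseq_uniq sM un.
  - move=> x xM; apply: (uvP 0 x) => //; rewrite -(perm_mem pE).
    by apply: (mem_subseq sM); rewrite inE xM orbT.
rewrite (@perm_matchings _ (mask (neg A) us ++ vs ++ v :: Y)); last first.
  by perm_by_count.
by rewrite (IH' true); apply: perm_matchings; perm_by_count.
Qed.

Lemma matchings_isolated us A :
  {subset us <= r} -> uniq us -> {in us &, forall x y, adj x y = false} ->
  size A = size us -> matchings (mask (neg A) us) = all id A.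
Proof.
move=> ur un ad sA.
elim: us A ur un ad sA => [|u us IH] [|a A] ur //= un ad.
  by move=> _; exact: matchings_nil.
case/andP: un => uus un [sA].
have ur' : {subset us <= r} by move=> x xu; rewrite ur // inE xu orbT.
case: a => /=.
  rewrite IH // => x y xu yu; apply: ad; rewrite inE ?xu ?yu orbT //.
apply: matchings_peel0.
- move=> x; rewrite inE => /orP[/eqP->|/mask_subset xu]; last exact: ur'.
  by rewrite ur // inE eqxx.
- rewrite /= mask_uniq // andbT; apply: contra uus; exact: mask_subset.
- by move=> x /mask_subset xu; rewrite ad // inE ?eqxx // xu orbT.
Qed.
End Matchings.

Local Open Scope ring_scope.

(** * Geometry of the quasi-octagon *)

Lemma adjacent_sym : symmetric adjacent.
Proof.
move=> u v; rewrite /adjacent eq_sym; congr (_ && _).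
by apply/hasP/hasP => -[e e1 e2]; exists e.
Qed.

Lemma adjacent_irr : irreflexive adjacent.
Proof. by move=> u; rewrite /adjacent eqxx. Qed.

Lemma adjacent_below (u v : cell) : diag v < diag u -> adjacent u v ->
  v.2 = (u.2.1, u.2.2 - 1) \/ v.2 = (u.2.1 + 1, u.2.2).
Proof.
case: u v => [k [x y]] [k' [x' y']]; rewrite /diag /level /= => lt.
case/andP => _ /hasP[[[p q] [r s]] eu ev].
suff [[-> ->]|[-> ->]] : (x' = x /\ y' = y - 1) \/ (x' = x + 1 /\ y' = y).
- by left.
- by right.
by move: k k' eu ev => [] []; rewrite !inE !xpair_eqE => eu ev; lia.
Qed.

Lemma adjacent_same_diag (u v : cell) : u.1 = v.1 -> diag u = diag v ->
  adjacent u v = false.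
Proof.
case: u v => [k [x y]] [k' [x' y']]; rewrite /diag /level /= => <- E.
apply/negP => /andP[ne /hasP[[[p q] [r s]] eu ev]].
have [xx yy] : x = x' /\ y = y'.
  by move: k eu ev {ne} => []; rewrite !inE !xpair_eqE => eu ev; lia.
by rewrite xx yy eqxx in ne.
Qed.

(** The bottom and right edges of the square [s] face the squares below and to the right, each of
    which shows its northwestern cell there. *)
Lemma adjacent_se (O : quasi_octagon) (s : point) (v : cell) :
  fundamental O v -> diag v < level s ->
  adjacent (se_cell O s) v =
    (v == nw_cell O (s.1, s.2 - 1)) || (v == nw_cell O (s.1 + 1, s.2)).
Proof.
move=> fv lt.
have ne : se_cell O s != v by apply: contraTneq lt => <-; rewrite /diag ltxx.
have vnw p : level p < level s -> p = v.2 -> adjacent (se_cell O s) v -> v = nw_cell O p.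
  case: v fv {lt ne} => k p' fv lt /= pp'; rewrite -{p'}pp' in fv *.
  move: fv; rewrite /fundamental /diag /nw_cell /=.
  case: (drawn O (level p)); case: k => //= _ /andP[_ /hasP[[[q q'] [r r']]]].
  case: s p lt => [x y] [x' y']; rewrite /se_cell /level /= => lt.
  by case: ifP => _; rewrite !inE !xpair_eqE => eu ev; exfalso; lia.
apply/idP/idP.
  move=> uv; have := uv; have [|E|E] := @adjacent_below (se_cell O s) v _ uv.
  - exact: lt.
  - move/(vnw _ _ (esym E)) => -> //; rewrite ?eqxx //.
    by rewrite /level /=; lia.
  - move/(vnw _ _ (esym E)) => -> //; rewrite ?eqxx ?orbT //.
    by rewrite /level /=; lia.
rewrite /adjacent ne /=; case: s {lt ne vnw} => x y.
case/orP => /eqP ->; apply/hasP.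
  exists ((x, y), (x + 1, y)); rewrite /se_cell /nw_cell /=; case: ifP => _;
    by rewrite ?subrK !inE eqxx ?orbT.
exists ((x + 1, y), (x + 1, y + 1)); rewrite /se_cell /nw_cell /=; case: ifP => _;
  by rewrite !inE eqxx ?orbT.
Qed.

Lemma adjacent_hypotenuse (s : point) : adjacent (UpTri, s) (DownTri, s).
Proof.
case: s => x y; rewrite /adjacent; apply/andP; split; first by apply/eqP => -[].
by apply/hasP; exists ((x, y), (x + 1, y + 1)); rewrite !inE eqxx ?orbT.
Qed.

Lemma adjacent_nw (O : quasi_octagon) (s : point) (v : cell) :
  drawn O (level s) -> fundamental O v -> diag v <= level s ->
  adjacent (nw_cell O s) v = (v == se_cell O s).
Proof.
move=> ds fv le; rewrite /nw_cell /se_cell ds.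
apply/idP/eqP => [|->]; last exact: adjacent_hypotenuse.
case: s v ds fv le => [x y] [k [x' y']]; rewrite /diag /level /= => ds fv le.
case/andP => ne /hasP[[[p q] [r s]] eu ev].
have [xx yy] : x' = x /\ y' = y.
  by move: k ev {ne fv} => []; move: eu; rewrite !inE !xpair_eqE => eu ev; lia.
move: fv ne; rewrite xx yy /fundamental /diag /level /= ds.
by case: k {ev} => //; rewrite eqxx.
Qed.

(** * Colours of the rows of cells *)

Section Coloring.
Variables (O : quasi_octagon) (black : cell -> bool).
Hypothesis col : is_coloring O black.

(** The cell at abscissa 0 represents its whole row, as [black_se] justifies. *)
Definition lower_black (c : int) : bool := black (se_cell O (0, c)).

Lemma black_se_nw x y : black (se_cell O (x, y)) = ~~ black (nw_cell O (x, y - 1)).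
Proof.
have := col.1 (se_cell O (x, y)) (nw_cell O (x, y - 1))
  (fundamental_se O _) (fundamental_nw O _).
rewrite adjacent_se ?fundamental_nw //= ?eqxx; last first.
  by rewrite /diag /level /=; lia.
by move/(_ isT); case: (black _); case: (black _).
Qed.

Lemma black_nw_se x y : black (nw_cell O (x, y)) = ~~ black (se_cell O (x - 1, y)).
Proof.
have := col.1 (se_cell O (x - 1, y)) (nw_cell O (x, y))
  (fundamental_se O _) (fundamental_nw O _).
rewrite adjacent_se ?fundamental_nw //=; last first.
  by rewrite /diag /level /=; lia.
rewrite subrK eqxx orbT.
by move/(_ isT); case: (black _); case: (black _).
Qed.

(** Going down and then left crosses two edges and arrives at the previous square of the diagonal,
    so the colour is unchanged. *)
Lemma black_se s : black (se_cell O s) = lower_black (level s).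
Proof.
have shift x y : black (se_cell O (x, y)) = black (se_cell O (x - 1, y - 1)).
  by rewrite black_se_nw black_nw_se negbK.
have shiftn (n : nat) x y :
    black (se_cell O (x, y)) = black (se_cell O (x - n%:Z, y - n%:Z)).
  elim: n => [|n ->]; first by rewrite !subr0.
  by rewrite shift; congr (black (se_cell O (_, _))); lia.
case: s => x y; rewrite /lower_black /level /=.
case: (lerP 0 x) => x0.
  by rewrite (shiftn `|x|%N); congr (black (se_cell O (_, _))); lia.
by rewrite [RHS](shiftn `|x|%N); congr (black (se_cell O (_, _))); lia.
Qed.

Lemma black_nw s : black (nw_cell O s) = ~~ lower_black (level s + 1).
Proof.
case: s => x y; rewrite black_nw_se black_se; congr (~~ lower_black _).
by rewrite /level /=; lia.
Qed.

(** A drawn-in diagonal separates two triangles of opposite colours; otherwise the upper and the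
    lower cell are one square. *)
Lemma lower_black_step c :
  lower_black c = if drawn O c then lower_black (c + 1) else ~~ lower_black (c + 1).
Proof.
have E : level (0, c) = c by rewrite /level /=; lia.
have := black_nw (0, c); rewrite E.
case: (boolP (drawn O c)) => dc nwE; last first.
  by rewrite -nwE /lower_black /se_cell /nw_cell E (negbTE dc).
have := col.1 (nw_cell O (0, c)) (se_cell O (0, c))
  (fundamental_nw O _) (fundamental_se O _).
rewrite adjacent_nw ?fundamental_se // ?E // ?eqxx.
move/(_ isT); rewrite nwE -/(lower_black c).
by case: (lower_black c); case: (lower_black _).
Qed.

End Coloring.

Lemma linked_nth (C : choiceType) (adj : rel C) (us ws S : seq C) x0 :
  (forall i, (i < size us)%N ->
     {in S, forall x, adj (nth x0 us i) x = (x \in take 2 (drop i ws))}) ->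
  linked adj us ws S.
Proof.
elim: us ws => //= u us IH ws usP; split.
  by have := usP 0%N isT; rewrite drop0.
apply: IH => i iu x xS; rewrite (usP i.+1 iu x xS).
by rewrite -[behead ws]drop1 drop_drop addn1.
Qed.

Lemma take2_drop_map_iota (C : eqType) (f : nat -> C) m i x : (i < m)%N ->
  (x \in take 2 (drop i [seq f j | j <- iota 0 m])) =
  (x == f i) || ((i.+1 < m)%N && (x == f i.+1)).
Proof.
move=> im; rewrite -map_drop -map_take drop_iota add0n.
case E : (m - i)%N => [|[|k]] /=; first by lia.
  have -> : (i.+1 < m)%N = false by lia.
  by rewrite inE orbF.
have -> : (i.+1 < m)%N by lia.
by rewrite take0 /= !inE.
Qed.

(** * Boundaries, widths and rows of the region *)

Section Boundary.
Variables (O : quasi_octagon) (black : cell -> bool).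
Hypothesis col : is_coloring O black.
Notation ne := (ne_point O black).
Notation sw := (sw_point O black).
Notation N := (nsteps O).

(* The n-th diagonal from the top. *)
Definition lvl (n : nat) : int := top_diag O - n%:Z.
Definition lower_black_at (n : nat) : bool := lower_black O black (lvl n).
Notation b := lower_black_at.

Lemma lvlS n : lvl n.+1 + 1 = lvl n.
Proof. by rewrite /lvl; lia. Qed.

Lemma level_ne n : level (ne n) = lvl n.
Proof.
elim: n => [|n IH] /=; first by rewrite /lvl /level /=; lia.
move: IH; rewrite /lvl /level; case: (ne n) => x y /=.
by case: (path_step _ _ _) => /=; lia.
Qed.

Lemma level_sw n : level (sw n) = lvl n.
Proof. by rewrite -level_ne /sw_point /reflect /level /=; lia. Qed.

(** These are the steps from B to C: the one leaving B is included, the one leaving C is not. *)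
Definition in_middle_zone (n : nat) : bool :=
  (nupper O <= n < nupper O + nmiddle O)%N.

Lemma path_step_South n :
  path_step O black (ne n) = if b n (+) in_middle_zone n then South else East.
Proof.
have := level_ne n; rewrite /path_step /path_cell /=.
case: (ne n) => x y lev.
have -> : (ell' O < level (x, y)) && (level (x, y) <= ell O) = in_middle_zone n.
  by rewrite lev /lvl /top_diag /ell' /in_middle_zone; lia.
rewrite /b -lev; case: (in_middle_zone n) => /=.
  rewrite (black_nw col) addbT; congr (if ~~ lower_black _ _ _ then _ else _).
  by rewrite /level /=; lia.
rewrite (black_se col) addbF; congr (if lower_black _ _ _ then _ else _).
by rewrite /level /=; lia.
Qed.

Definition wd (n : nat) : int := (ne n).1 - (sw n).1.
Definition row_width (n : nat) : nat := `|wd n|%N.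
Notation W := row_width.

Lemma boundary_step n :
  if b n (+) in_middle_zone n then
    sw n.+1 = ((sw n).1 + 1, (sw n).2) /\ wd n.+1 = wd n - 1
  else sw n.+1 = ((sw n).1, (sw n).2 - 1) /\ wd n.+1 = wd n + 1.
Proof.
rewrite /wd /sw_point /= path_step_South; case: (ne n) => x y.
by case: (_ (+) _); rewrite /reflect /=; split; try (congr (_, _); rewrite /=); lia.
Qed.

Hypothesis a_gt0 : (0 < side_a O)%N.
Hypothesis disj : boundaries_disjoint O black.

(** The width starts at [side_a O] and changes by one at each step; it cannot reach 0, since there
    the boundaries would meet. *)
Lemma wd_gt0 n : (n <= N)%N -> 0 < wd n.
Proof.
elim: n => [|n IH] nN; first by rewrite /wd /sw_point /reflect /=; lia.
have := IH (ltnW nN); have := boundary_step n.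
have : wd n.+1 != 0.
  apply: contra (disj nN nN) => /eqP w0.
  have := level_ne n.+1; have := level_sw n.+1; move: w0; rewrite /wd.
  case: (ne n.+1) => x y; case: (sw n.+1) => x' y'; rewrite /level xpair_eqE /=.
  by lia.
by case: (_ (+) _) => + [_]; lia.
Qed.

Lemma row_widthE n : (n <= N)%N -> (W n)%:Z = wd n.
Proof. by move=> nN; have := wd_gt0 nN; rewrite /row_width; lia. Qed.

Lemma row_width_gt0 n : (n <= N)%N -> (0 < W n)%N.
Proof. by move=> nN; have := wd_gt0 nN; rewrite /row_width; lia. Qed.

Definition pt (n i : nat) : point := ((sw n).1 + i%:Z, (sw n).2 + i%:Z).

Lemma level_pt n i : level (pt n i) = lvl n.
Proof. by rewrite -level_sw /level /=; lia. Qed.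

Lemma row_step n : (n < N)%N ->
  if b n (+) in_middle_zone n then
    W n = (W n.+1).+1 /\
    (forall i, pt n.+1 i = ((pt n i).1 + 1, (pt n i).2))
  else W n.+1 = (W n).+1 /\
    (forall i, pt n.+1 i = ((pt n i).1, (pt n i).2 - 1)).
Proof.
move=> nN; have := row_widthE (ltnW nN); have := row_widthE nN.
have := boundary_step n; rewrite /pt; case: (_ (+) _) => -[-> ->] /= E E';
  split; try lia.
  by move=> i; congr (_, _); lia.
by move=> i; congr (_, _); lia.
Qed.

(** On a diagonal not drawn in, the upper and the lower row coincide. Thus the cells between
    consecutive diagonals always form a zigzag from a lower row to the next upper row. *)
Definition upper_row (n : nat) : seq cell :=
  [seq nw_cell O (pt n i) | i <- iota 0 (W n)].
Definition lower_row (n : nat) : seq cell :=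
  [seq se_cell O (pt n i) | i <- iota 0 (W n)].

Lemma size_upper_row n : size (upper_row n) = W n.
Proof. by rewrite size_map size_iota. Qed.

Lemma size_lower_row n : size (lower_row n) = W n.
Proof. by rewrite size_map size_iota. Qed.

Lemma pt_inj n : injective (pt n).
Proof. by move=> i j [] /addrI [] ->. Qed.

Lemma uniq_upper_row n : uniq (upper_row n).
Proof.
rewrite map_inj_uniq ?iota_uniq // => i j [_ E _]; apply: (@pt_inj n).
by move/addrI: E => [->].
Qed.

Lemma uniq_lower_row n : uniq (lower_row n).
Proof.
rewrite map_inj_uniq ?iota_uniq // => i j [_ E _]; apply: (@pt_inj n).
by move/addrI: E => [->].
Qed.

Lemma upper_rowP n u : u \in upper_row n ->
  [/\ fundamental O u, diag u = lvl n & black u = ~~ lower_black O black (lvl n + 1)].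
Proof.
case/mapP => i _ ->; split; first exact: fundamental_nw.
  exact: level_pt.
by rewrite (black_nw col) level_pt.
Qed.

Lemma lower_rowP n u : u \in lower_row n ->
  [/\ fundamental O u, diag u = lvl n & black u = b n].
Proof.
case/mapP => i _ ->; split; first exact: fundamental_se.
  exact: level_pt.
by rewrite (black_se col) level_pt.
Qed.

Definition level_cells (n : nat) : seq cell :=
  if drawn O (lvl n) then
    (if (0 < n)%N then upper_row n else [::]) ++
    (if (n < N)%N then lower_row n else [::])
  else lower_row n.

Lemma region_level_cells n : drawn O (top_diag O) -> drawn O (bottom_diag O) ->
  (n <= N)%N -> cells_at O black n =i level_cells n.
Proof.
move=> dtop dbot nN u; rewrite /cells_at.
have swE := surjective_pairing (sw n).
case E : (sw n) => [x y].
have wE : `|(ne n).1 - x|%N = W n by rewrite /row_width /wd E.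
rewrite wE mem_filter.
have ptE i : (x + i%:Z, y + i%:Z) = pt n i by rewrite /pt E.
have lbot : lvl N = bottom_diag O.
  by rewrite /lvl /bottom_diag /ell' /top_diag /nsteps; lia.
have inj : (lvl n == lvl N) = (n == N) by rewrite /lvl; lia.
apply/idP/idP.
  case/andP => /and3P[fu bu au] /allpairsP[[k i] /= [_ iW uE]].
  have {}uE : u = (k, pt n i) by rewrite uE ptE.
  move: fu bu au; rewrite uE /fundamental /below /above /diag /= level_pt => fu bu au.
  rewrite /level_cells; move: fu; case: ifP => dn /eqP fu; last first.
    by apply/mapP; exists i => //; rewrite /se_cell level_pt dn; case: (k) fu.
  rewrite mem_cat; case: k uE fu bu au => // uE _ bu au; apply/orP.
    left; rewrite (_ : (0 < n)%N); last by move: bu; rewrite /lvl; lia.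
    by apply/mapP; exists i => //; rewrite /nw_cell level_pt dn.
  right; rewrite (_ : (n < N)%N); last first.
    by rewrite ltn_neqAle nN andbT -inj lbot; move: au; lia.
  by apply/mapP; exists i => //; rewrite /se_cell level_pt dn.
move=> ul.
have [i [iW [uE bu au]]] : exists i, i \in iota 0 (W n) /\
    [/\ u = (u.1, pt n i), below (top_diag O) u & above (bottom_diag O) u].
  move: ul; rewrite /level_cells; case: ifP => dn.
    rewrite mem_cat => /orP[]; case: ifP => // nb /mapP[i iW ->]; exists i;
      rewrite /nw_cell /se_cell /below /above /diag /= level_pt dn; split=> //; split => //.
    - by rewrite /lvl; lia.
    - by rewrite -lbot /lvl; lia.
    - by rewrite /lvl; lia.
    - by rewrite -lbot /lvl; lia.
  move=> /mapP[i iW ->]; exists i; rewrite /se_cell /below /above /diag /= level_pt dn.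
  split=> //; split=> //.
    have : lvl n != top_diag O by apply: contraFN dn => /eqP->.
    by rewrite /lvl; lia.
  have : lvl n != bottom_diag O by apply: contraFN dn => /eqP->.
  by rewrite -lbot /lvl; lia.
rewrite bu au !andbT; apply/andP; split.
  move: ul; rewrite /level_cells; case: ifP => _.
    rewrite mem_cat => /orP[]; case: ifP => // _; first by case/upper_rowP.
    by case/lower_rowP.
  by case/lower_rowP.
apply/allpairsP; exists (u.1, i); rewrite /= ptE; split=> //.
by rewrite !inE; case: (u.1).
Qed.

Hypothesis dtop : drawn O (top_diag O).
Hypothesis dbot : drawn O (bottom_diag O).
Notation rgn := (region O black).
Notation count_matchings := (matchings adjacent rgn).

Lemma lvl_inj : injective lvl.
Proof. by move=> m n; rewrite /lvl; lia. Qed.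

Lemma lvl0 : lvl 0 = top_diag O.
Proof. by rewrite /lvl subr0. Qed.

Lemma lvlN : lvl N = bottom_diag O.
Proof. by rewrite /lvl /bottom_diag /ell' /top_diag /nsteps; lia. Qed.

Lemma mem_region u : reflect (exists2 n, (n <= N)%N & u \in level_cells n) (u \in rgn).
Proof.
apply: (iffP flatten_mapP) => -[n]; first rewrite mem_iota => /andP[_ nN].
  by rewrite region_level_cells //; exists n.
by move=> nN; rewrite -region_level_cells // => un; exists n => //; rewrite mem_iota.
Qed.

Lemma upper_lower_row n : ~~ drawn O (lvl n) -> upper_row n = lower_row n.
Proof.
move=> dn; apply: eq_map => i.
by rewrite /nw_cell /se_cell level_pt (negbTE dn).
Qed.

Lemma level_cellsP n u : u \in level_cells n -> fundamental O u /\ diag u = lvl n.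
Proof.
rewrite /level_cells; case: ifP => _; last by case/lower_rowP.
rewrite mem_cat => /orP[]; case: ifP => // _; first by case/upper_rowP.
by case/lower_rowP.
Qed.

Lemma upper_row_region n : (0 < n <= N)%N -> {subset upper_row n <= rgn}.
Proof.
case/andP => n0 nN u un; apply/mem_region; exists n => //.
rewrite /level_cells; case: ifP => dn; last by rewrite -upper_lower_row ?dn.
by rewrite n0 mem_cat un.
Qed.

Lemma lower_row_region n : (n < N)%N -> {subset lower_row n <= rgn}.
Proof.
move=> nN u un; apply/mem_region; exists n; first exact: ltnW.
rewrite /level_cells; case: ifP => dn //.
by rewrite nN mem_cat un orbT.
Qed.

Lemma disjoint_rows n u : drawn O (lvl n) -> u \in upper_row n -> u \notin lower_row n.
Proof.
move=> dn /mapP[i _ ->]; apply/mapP => -[j _].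
by rewrite /nw_cell /se_cell !level_pt dn.
Qed.

Lemma uniq_level_cells n : uniq (level_cells n).
Proof.
rewrite /level_cells; case: ifP => dn; last exact: uniq_lower_row.
rewrite cat_uniq; case: ifP => _; case: ifP => _ //=.
- rewrite uniq_upper_row uniq_lower_row andbT /=; apply/hasPn => u.
  by apply: contraTN => /(disjoint_rows dn).
- by rewrite uniq_upper_row.
- by rewrite uniq_lower_row andbT; apply/hasPn.
Qed.

(** * The transfer from one diagonal to the next *)

Definition cells_below (n : nat) : seq cell :=
  flatten [seq level_cells m | m <- iota n.+1 (N - n)].

Lemma cells_belowS n : (n < N)%N ->
  cells_below n = level_cells n.+1 ++ cells_below n.+1.
Proof. by move=> nN; rewrite /cells_below -(subnSK nN). Qed.

Lemma cells_belowP n u : u \in cells_below n ->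
  [/\ u \in rgn, fundamental O u & diag u < lvl n].
Proof.
case/flatten_mapP => m; rewrite mem_iota => /andP[nm mN] um.
have mN' : (m <= N)%N by lia.
have [fu du] := level_cellsP um; split=> //.
  by apply/mem_region; exists m.
by rewrite du /lvl; lia.
Qed.

Lemma uniq_cells_below n : uniq (cells_below n).
Proof.
rewrite /cells_below; elim: (N - n)%N n.+1 => //= k IH m.
rewrite cat_uniq uniq_level_cells IH andbT /=; apply/hasPn => u.
case/flatten_mapP => j; rewrite mem_iota => /andP[mj _] uj.
apply/negP => /level_cellsP[_ dm]; have [_ dj] := level_cellsP uj.
by have := lvl_inj (etrans (esym dm) dj); lia.
Qed.

(** The cells still to be covered once everything above the n-th lower row is tiled; [D] marks the
    uncovered cells of that row. *)
Definition state (n : nat) (D : bitseq) : seq cell :=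
  mask D (lower_row n) ++ cells_below n.

(* P lists the particles crossing below the n-th diagonal: the cells of the lower
   row matched downwards if that row is black, those not matched downwards if it
   is white. *)
Definition completions (n : nat) (P : bitseq) : nat :=
  if (n < N)%N then count_matchings (state n (if b n then P else neg P))
  else all id P.

Definition rest (n : nat) : seq cell :=
  (if drawn O (lvl n) && (n < N)%N then lower_row n else [::]) ++ cells_below n.

Lemma cells_below_rest n : (n < N)%N -> cells_below n = upper_row n.+1 ++ rest n.+1.
Proof.
move=> nN; rewrite cells_belowS // /level_cells /rest.
by case: (boolP (drawn O _)) => [_|/upper_lower_row ->]; rewrite /= ?catA.
Qed.

(** This serves to discard the neighbours of end cells that stick out of the region. *)
Lemma nw_in_row n p u : u = nw_cell O p -> level p = lvl n.+1 -> (n < N)%N ->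
  u \in lower_row n ++ cells_below n -> exists2 j, (j < W n.+1)%N & p = pt n.+1 j.
Proof.
move=> uE lp nN; rewrite cells_below_rest // /rest !mem_cat => /or4P[].
- case/lower_rowP => _; rewrite uE /diag /= lp => /lvl_inj; lia.
- case/mapP => j; rewrite mem_iota => /andP[_ jW]; rewrite uE => -[_ ->].
  by exists j.
- case: ifP => // /andP[dn _] /mapP[j _]; rewrite uE /nw_cell /se_cell lp level_pt dn //.
- by case/cells_belowP => _ _; rewrite uE /diag /= lp ltxx.
Qed.

Section Step.
Variable n : nat.
Hypothesis nN : (n < N)%N.
Let S := lower_row n ++ upper_row n.+1 ++ rest n.+1.

Lemma S_below : S = lower_row n ++ cells_below n.
Proof. by rewrite cells_below_rest. Qed.

Lemma S_region : {subset S <= rgn}.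
Proof.
move=> u; rewrite S_below mem_cat => /orP[/lower_row_region|/cells_belowP[]] //.
exact.
Qed.

Lemma uniq_S : uniq S.
Proof.
rewrite S_below cat_uniq uniq_lower_row uniq_cells_below andbT /=.
apply/hasPn => u /cells_belowP[_ _ du]; apply/negP => /lower_rowP[_ E _].
by rewrite E ltxx in du.
Qed.

Lemma adjacent_row i x : x \in S ->
  adjacent (se_cell O (pt n i)) x =
  (x == nw_cell O ((pt n i).1, (pt n i).2 - 1)) ||
  (x == nw_cell O ((pt n i).1 + 1, (pt n i).2)).
Proof.
rewrite S_below mem_cat => /orP[|/cells_belowP[_ fx dx]]; last first.
  by rewrite adjacent_se // level_pt.
case/mapP => j _ ->; rewrite adjacent_same_diag; first last.
- by rewrite /diag /= !level_pt.
- by rewrite /= !level_pt.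
have := level_pt n i; have := level_pt n j.
case: (pt n i) => x1 y1; case: (pt n j) => x2 y2 /= E2 E1.
apply/esym/norP; rewrite /se_cell /nw_cell; split; apply/eqP => -[_ E E'];
  by move: E1 E2; rewrite E E' /level /=; lia.
Qed.

Lemma linked_up : W n.+1 = (W n).+1 ->
  (forall i, pt n.+1 i = ((pt n i).1, (pt n i).2 - 1)) ->
  linked adjacent (lower_row n) (upper_row n.+1) S.
Proof.
move=> WE ptE; apply: (@linked_nth _ _ _ _ _ (Full, (0, 0))) => i.
rewrite size_lower_row => iW x xS.
rewrite (nth_map 0%N) ?size_iota // nth_iota // add0n adjacent_row //.
rewrite take2_drop_map_iota; last by rewrite WE; lia.
rewrite WE ltnS iW andTb -ptE.
congr (_ || (x == nw_cell O _)).
by have := ptE i.+1; rewrite /pt /=; move=> ->; congr (_, _); lia.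
Qed.

(** When the row narrows, the bottom neighbour of the first cell and the right neighbour of the last
    lie outside the region. *)
Lemma linked_down u us : W n = (W n.+1).+1 ->
  (forall i, pt n.+1 i = ((pt n i).1 + 1, (pt n i).2)) ->
  lower_row n = u :: us ->
  {in S, forall x, adjacent u x = (x == nw_cell O (pt n.+1 0))} /\
  linked adjacent us (upper_row n.+1) S.
Proof.
move=> WE ptE; rewrite /lower_row WE /= => -[<- <-]; split=> [x xS|].
  rewrite adjacent_row // -ptE; case: eqP => //= xE.
  case: (@nw_in_row n _ _ xE) => //.
  - by have := level_pt n 0; rewrite /lvl /level /=; lia.
  - by rewrite -S_below.
  - move=> j _; rewrite ptE => -[]; rewrite /pt /=; lia.
apply: (@linked_nth _ _ _ _ _ (Full, (0, 0))) => i.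
rewrite size_map size_iota => iW x xS.
rewrite (nth_map 0%N) ?size_iota // nth_iota // adjacent_row //.
rewrite take2_drop_map_iota //.
have -> : ((pt n (1 + i)).1, (pt n (1 + i)).2 - 1) = pt n.+1 i.
  by rewrite ptE /pt /=; congr (_, _); lia.
rewrite -ptE add1n; case: eqP => //= _.
case: (x =P _) => [xE|_]; last by rewrite andbF.
rewrite andbT; case: (@nw_in_row n _ _ xE) => //.
- exact: level_pt.
- by rewrite -S_below.
- by move=> j jW /(@pt_inj n.+1) ->; rewrite jW.
Qed.

(** The longer of the two rows comes first; it is the upper one exactly when the region narrows. *)
Definition kernel (D A : bitseq) : bool :=
  if b n (+) in_middle_zone n then matched D A else matched A D.

Lemma matchings_state D : size D = W n ->
  count_matchings (state n D) =
  (\sum_(A <- bits (W n.+1))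
    kernel D A * count_matchings (mask (neg A) (upper_row n.+1) ++ rest n.+1))%N.
Proof.
move=> sD; rewrite /state cells_below_rest // /kernel.
have := row_step nN; case: (_ (+) _) => -[WE ptE].
  have w0 := row_width_gt0 nN.
  case lE : (lower_row n) => [|u us].
    by have := size_lower_row n; rewrite lE WE.
  have [u0 usl] := linked_down WE ptE lE.
  have sus : size us = W n.+1.
    by have := size_lower_row n; rewrite lE WE /= => -[].
  have := size_upper_row n.+1.
  case uE : (upper_row n.+1) => [|w ws] sw; first by move: w0; rewrite -sw.
  have SE : S = u :: us ++ w :: ws ++ rest n.+1 by rewrite /S lE uE.
  rewrite matchings_zigzag_down; first by rewrite sw.
  - exact: adjacent_sym.
  - exact: adjacent_irr.
  - by move=> x; rewrite -SE => /S_region.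
  - by rewrite -SE uniq_S.
  - move=> x; rewrite -SE => /u0 ->; congr (_ == _).
    have := uE; rewrite /upper_row -(ltn_predK w0) /= => -[].
    by [].
  - by rewrite -SE -uE.
  - by rewrite sD WE /= sus.
  - by rewrite sus sw.
rewrite matchings_zigzag_up; first by rewrite size_upper_row.
- exact: adjacent_sym.
- exact: adjacent_irr.
- exact: S_region.
- exact: uniq_S.
- exact: linked_up.
- by rewrite size_lower_row.
- by rewrite size_upper_row size_lower_row.
Qed.

End Step.

Hypothesis bottom : forall n, n.+1 = N -> b n.

Lemma lower_black_atS n : b n.+1 = if drawn O (lvl n.+1) then b n else ~~ b n.
Proof. by rewrite /b (lower_black_step col) lvlS. Qed.

(** On the bottom diagonal every cell must already be matched. On another drawn-in diagonal the
    lower triangles left are those below the cells of [A]; on an undrawn one the squares left are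
    those outside [A], but the colour convention switches too, so the particles agree. *)
Lemma matchings_rest n A : (n < N)%N -> size A = W n.+1 ->
  count_matchings (mask (neg A) (upper_row n.+1) ++ rest n.+1) =
  completions n.+1 (if b n then A else neg A).
Proof.
move=> nN sA; have := nN; rewrite leq_eqVlt => /orP[/eqP nE|nN1].
  have E : rest n.+1 = [::] by rewrite /rest /cells_below nE ltnn andbF subnn.
  rewrite /completions nE ltnn bottom // -nE E cats0.
  apply: matchings_isolated => //.
  - exact: adjacent_sym.
  - exact: adjacent_irr.
  - by apply: upper_row_region; rewrite /= nE.
  - exact: uniq_upper_row.
  - move=> x y /mapP[i _ ->] /mapP[j _ ->]; apply: adjacent_same_diag.
      by rewrite /= !level_pt.
    by rewrite /diag /= !level_pt.
  - by rewrite size_upper_row.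
have -> : completions n.+1 (if b n then A else neg A) =
    count_matchings (state n.+1 (if drawn O (lvl n.+1) then A else neg A)).
  rewrite /completions nN1 lower_black_atS.
  by case: (drawn O _); case: (b n); rewrite ?negK.
rewrite /rest nN1 andbT /state; case: (boolP (drawn O _)) => dn; last first.
  by rewrite (upper_lower_row dn).
pose Sn := lower_row n ++ upper_row n.+1 ++ rest n.+1.
have SE : Sn = lower_row n ++ upper_row n.+1 ++ lower_row n.+1 ++ cells_below n.+1.
  by rewrite /Sn /rest nN1 dn.
have sub : {subset upper_row n.+1 ++ lower_row n.+1 ++ cells_below n.+1 <= Sn}.
  by move=> x xs; rewrite SE mem_cat xs orbT.
apply: matchings_hypotenuses.
- exact: adjacent_sym.
- exact: adjacent_irr.
- by move=> x /sub /(S_region nN).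
- have : uniq Sn := uniq_S nN.
  by rewrite SE; apply: subseq_uniq; apply: suffix_subseq.
- by rewrite size_upper_row size_lower_row.
- by rewrite size_upper_row.
move=> i x0; rewrite size_upper_row => iW x xs.
rewrite !(nth_map 0%N) ?size_iota // nth_iota // add0n.
have [fx dx] : fundamental O x /\ diag x <= lvl n.+1.
  move: xs; rewrite !mem_cat.
  by case/or3P => [/upper_rowP[? -> _]|/lower_rowP[? -> _]|/cells_belowP[_ ? /ltW]].
by rewrite adjacent_nw ?level_pt.
Qed.

Lemma completions_step n P : (n < N)%N -> size P = W n ->
  completions n P = (\sum_(A <- bits (W n.+1))
    kernel n (if b n then P else neg P) A *
    completions n.+1 (if b n then A else neg A))%N.
Proof.
move=> nN sP; rewrite {1}/completions nN matchings_state //; last first.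
  by case: (b n); rewrite ?size_neg.
by apply: eq_big_seq => A /size_bits sA; rewrite matchings_rest.
Qed.

(** For a white row, passing from marked cells to particles complements both arguments and turns
    [matched] into [interlaced]. *)
Lemma outer_completions n : (n < N)%N -> ~~ in_middle_zone n ->
  outer_step W b completions n.
Proof.
move=> nN /negbTE mid; have := row_step nN; rewrite /outer_step mid addbF.
have := completions_step nN; rewrite /kernel mid addbF.
case: (b n) => step [WE _]; split=> // P sP; rewrite step //.
  by rewrite /up_black sP WE.
rewrite /down_white sP WE -[RHS]big_bits_neg; apply: eq_bigr => A _.
by rewrite /interlaced negK.
Qed.

Lemma inner_completions n : (n < N)%N -> in_middle_zone n ->
  inner_step W b completions n.
Proof.
move=> nN mid; have := row_step nN; rewrite /inner_step mid addbT.
have := completions_step nN; rewrite /kernel mid addbT.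
case: (b n) => step [WE _]; split=> // P sP; rewrite step //.
  by rewrite /down_black sP WE.
rewrite /up_white sP WE -[RHS]big_bits_neg; apply: eq_bigr => A _.
by rewrite /interlaced negK.
Qed.

Lemma completionsN P : completions N P = all id P.
Proof. by rewrite /completions ltnn. Qed.

Hypothesis N_gt0 : (0 < N)%N.
Hypothesis top_white : ~~ b 0.

(** The top row is white and all of it must be matched downwards, so there are no particles at the
    start. *)
Lemma card_tilings : #|tilings O black| = completions 0 (nseq (W 0) false).
Proof.
have -> : #|tilings O black| = count_matchings rgn.
  rewrite /matchings; congr #|pred_of_set _|; apply/setP => P.
  rewrite !inE; congr (partition P _ && _).
  by apply/setP => x; rewrite !inE (valP x).
rewrite /completions N_gt0 (negbTE top_white) /state.
have -> : neg (nseq (W 0) false) = nseq (W 0) true by rewrite /neg map_nseq.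
apply: eq_matchings => u; rewrite mask_true ?size_lower_row // [RHS]mem_cat.
apply/idP/idP => [/mem_region[[|n] nN un]|/orP[u0|/cells_belowP[]] //].
- by move: un; rewrite /level_cells lvl0 dtop /= N_gt0 => ->.
- apply/orP; right; apply/flatten_mapP; exists n.+1 => //.
  by rewrite mem_iota; lia.
by apply/mem_region; exists 0%N => //; rewrite /level_cells lvl0 dtop /= N_gt0.
Qed.

(** * Heights and numbers of regular cells *)

Lemma uniq_flatten_map (I T : eqType) (f : I -> seq T) (s : seq I) :
  uniq s -> (forall i, uniq (f i)) ->
  {in s &, forall i j u, u \in f i -> u \in f j -> i = j} ->
  uniq (flatten [seq f i | i <- s]).
Proof.
elim: s => //= i s IH /andP[ins us] fu inj.
rewrite cat_uniq fu IH //=; last first.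
  by move=> j k js ks; apply: inj; rewrite inE ?js ?ks orbT.
rewrite andbT; apply/hasPn => u /flatten_mapP[j js uj]; apply/negP => ui.
have ij : i = j by apply: (inj i j _ _ u) => //; rewrite inE ?eqxx // js orbT.
by rewrite ij js in ins.
Qed.

(** Nonempty rows on distinct diagonals are disjoint and have distinct labels, so heights and cell
    counts are read off a list of row indices. *)
Lemma count_rows (ns : seq nat) (row : nat -> seq cell) (lev : nat -> nat)
    (P : pred cell) :
  uniq ns -> {in ns, forall n, 0 < size (row n)}%N -> (forall n, uniq (row n)) ->
  injective lev ->
  (forall n u v, u \in row n -> v \in row n -> row_label black u = row_label black v) ->
  (forall n u, u \in row n -> diag u = lvl (lev n)) ->
  (forall u, (u \in rgn) && P u = has (fun n => u \in row n) ns) ->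
  num_rows O black P = size ns /\ num_cells O black P = (\sum_(n <- ns) size (row n))%N.
Proof.
move=> uns row0 urow ilev rowl rowd rowP.
have sep n m u : u \in row n -> u \in row m -> n = m.
  by move=> /rowd un /rowd um; apply/ilev/lvl_inj; rewrite -un um.
split.
  pose lab n := row_label black (head (Full, (0, 0)) (row n)).
  have hd n : n \in ns -> head (Full, (0, 0)) (row n) \in row n.
    by move=> /row0; case: (row n) => // u s _; rewrite inE eqxx.
  rewrite /num_rows -(size_map lab ns); apply: perm_size; apply: uniq_perm.
  - exact: undup_uniq.
  - rewrite map_inj_in_uniq // => m n /hd mh /hd nh [_ _ E].
    by apply/ilev/lvl_inj; rewrite -(rowd _ _ mh) -(rowd _ _ nh).
  - move=> l; rewrite mem_undup; apply/mapP/mapP => -[u].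
      rewrite mem_filter andbC rowP => /hasP[n nns un] ->; exists n => //.
      by apply: (rowl n) => //; apply: hd.
    move=> nns ->; exists (head (Full, (0, 0)) (row u)) => //.
    by rewrite mem_filter andbC rowP; apply/hasP; exists u => //; apply: hd.
pose L := flatten [seq row n | n <- ns].
have LP u : (u \in L) = (u \in rgn) && P u.
  by rewrite rowP; apply/flatten_mapP/hasP.
have uL : uniq L by apply: uniq_flatten_map => // m n _ _ u; apply: sep.
rewrite /num_cells (_ : (\sum_(n <- ns) size (row n))%N = size L); last first.
  by rewrite size_flatten /shape -map_comp sumnE big_map.
have -> : #|[set u : region_cell O black | P (val u)]| =
    size (pmap insub L : seq (region_cell O black)).
  rewrite -(card_uniqP (pmap_sub_uniq _ uL)); apply: eq_card => u.
  by rewrite inE mem_pmap_sub LP (valP u).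
rewrite size_pmap_sub; apply/eqP; rewrite -all_count; apply/allP => u.
by rewrite LP => /andP[].
Qed.

Lemma upper_row_kind n u : u \in upper_row n ->
  u.1 = if drawn O (lvl n) then UpTri else Full.
Proof. by case/mapP => i _ ->; rewrite /nw_cell level_pt. Qed.

Lemma lower_row_kind n u : u \in lower_row n ->
  u.1 = if drawn O (lvl n) then DownTri else Full.
Proof. by case/mapP => i _ ->; rewrite /se_cell level_pt. Qed.

Lemma black_upper_row n u : u \in upper_row n.+1 -> black u = ~~ b n.
Proof. by case/upper_rowP => _ _ ->; rewrite lvlS. Qed.

Lemma region_kind u : u \in rgn -> exists n, diag u = lvl n /\
  match u.1 with
  | UpTri => u \in upper_row n /\ (0 < n <= N)%N
  | DownTri => u \in lower_row n /\ (n < N)%N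
  | Full => [/\ u \in upper_row n, u \in lower_row n & (0 < n < N)%N]
  end.
Proof.
case/mem_region => n nN un; have [_ du] := level_cellsP un.
exists n; split=> //; move: un; rewrite /level_cells.
case: (boolP (drawn O (lvl n))) => dn.
  rewrite mem_cat => /orP[]; case: ifP => // n0 un.
    by rewrite (upper_row_kind un) dn; split=> //; apply/andP.
  by rewrite (lower_row_kind un) dn.
move=> un; rewrite (lower_row_kind un) (negbTE dn) (upper_lower_row dn); split=> //.
apply/andP; split.
  by case: (posnP n) dn => // ->; rewrite lvl0 dtop.
by rewrite ltn_neqAle nN andbT; apply: contraNneq dn => ->; rewrite lvlN.
Qed.

Hypothesis dell : drawn O (ell O).
Hypothesis dell' : drawn O (ell' O).

Lemma count_iota (p : pred nat) n :
  size [seq m <- iota 0 n | p m] = (\sum_(m < n) p m)%N.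
Proof.
rewrite size_filter -sum1_count big_mkcond -{1}[n]subn0 -/(index_iota 0 n).
by rewrite big_mkord; apply: eq_bigr => i _; case: (p i).
Qed.

Lemma sum_iota (p : pred nat) (F : nat -> nat) n :
  (\sum_(m <- [seq m <- iota 0 n | p m]) F m = \sum_(m < n | p m) F m)%N.
Proof.
by rewrite big_filter -{1}[n]subn0 -/(index_iota 0 n) big_mkord.
Qed.

Lemma row_label_upper n u v : u \in upper_row n -> v \in upper_row n ->
  row_label black u = row_label black v.
Proof.
move=> un vn; have [_ du bu] := upper_rowP un; have [_ dv bv] := upper_rowP vn.
by rewrite /row_label (upper_row_kind un) (upper_row_kind vn) du dv bu bv.
Qed.

Lemma row_label_lower n u v : u \in lower_row n -> v \in lower_row n ->
  row_label black u = row_label black v.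
Proof.
move=> un vn; have [_ du bu] := lower_rowP un; have [_ dv bv] := lower_rowP vn.
by rewrite /row_label (lower_row_kind un) (lower_row_kind vn) du dv bu bv.
Qed.

(** Regular cells above the lower distinguished diagonal form upper rows, and the upper row [m.+1]
    is black exactly when the lower row [m] is white. *)
Lemma upper_part_rows :
  upper_height O black = (\sum_(m < nupper O) ~~ b m)%N /\
  num_cells O black (upper_black_regular O black) =
    (\sum_(m < nupper O | ~~ b m) W m.+1)%N.
Proof.
have NE : N = (nupper O + nmiddle O + nlower O)%N by [].
have := @count_rows [seq m <- iota 0 (nupper O) | ~~ b m]
  (fun m => upper_row m.+1) S (upper_black_regular O black).
rewrite count_iota sum_iota => -[].
- by rewrite filter_uniq ?iota_uniq.
- move=> m; rewrite mem_filter mem_iota => /andP[_ /andP[_ mn]].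
  by rewrite size_upper_row row_width_gt0 //; lia.
- by move=> m; apply: uniq_upper_row.
- by move=> m n [].
- by move=> n u v; apply: row_label_upper.
- by move=> n u /upper_rowP[].
- move=> u; apply/andP/hasP.
    case=> /region_kind[n [du nu]].
    rewrite /upper_black_regular /in_upper /regular /above /below => /and3P[].
    move: nu du; rewrite /lvl /ell' /top_diag; case: u.1 => /=.
    + case: n => [|n] [un _ nN] // -> ab _ bu; exists n => //.
      by rewrite mem_filter mem_iota -(black_upper_row un) bu; lia.
    + case: n => [|n] [un nN] // -> ab _ bu; exists n => //.
      by rewrite mem_filter mem_iota -(black_upper_row un) bu; lia.
    + by move=> _ ->; lia.
  case=> m; rewrite mem_filter mem_iota => /andP[bm /andP[_ mn]] um.
  have [_ du _] := upper_rowP um; split.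
    by apply: upper_row_region um; lia.
  rewrite /upper_black_regular (black_upper_row um) bm andbT.
  rewrite /in_upper /regular /above du (upper_row_kind um).
  case: (boolP (drawn O _)) => dm /=.
    by rewrite /lvl /ell' /top_diag; lia.
  have : lvl m.+1 != ell O by apply: contraNneq dm => ->.
  by rewrite /lvl /top_diag; lia.
move=> E1 E2; rewrite /upper_height E1 E2; split=> //.
by apply: eq_bigr => m _; rewrite size_upper_row.
Qed.

Lemma middle_part_rows :
  middle_height O black = (\sum_(m < nmiddle O) b (nupper O + m))%N /\
  num_cells O black (middle_white_regular O black) =
    (\sum_(m < nmiddle O | b (nupper O + m)) W (nupper O + m).+1)%N.
Proof.
have NE : N = (nupper O + nmiddle O + nlower O)%N by [].
have := @count_rows [seq m <- iota 0 (nmiddle O) | b (nupper O + m)]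
  (fun m => upper_row (nupper O + m).+1) (fun m => (nupper O + m).+1)
  (middle_white_regular O black).
rewrite (count_iota (fun m => b (nupper O + m)))
  (sum_iota (fun m => b (nupper O + m))) => -[].
- by rewrite filter_uniq ?iota_uniq.
- move=> m; rewrite mem_filter mem_iota => /andP[_ /andP[_ mn]].
  by rewrite size_upper_row row_width_gt0 //; lia.
- by move=> m; apply: uniq_upper_row.
- by move=> m n [/addnI].
- by move=> n u v; apply: row_label_upper.
- by move=> n u /upper_rowP[].
- move=> u; apply/andP/hasP.
    case=> /region_kind[n [du nu]].
    rewrite /middle_white_regular /in_middle /regular /above /below => /and3P[].
    move: nu du; rewrite /lvl /ell' /top_diag; case: u.1 => /=.
    + case: n => [|n] [un _ nN] // -> ab _ bu; exists (n - nupper O)%N.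
        rewrite mem_filter mem_iota subnKC; last by lia.
        by rewrite -[b n]negbK -(black_upper_row un) bu; lia.
      by rewrite subnKC //; lia.
    + case: n => [|n] [un nN] // -> ab _ bu; exists (n - nupper O)%N.
        rewrite mem_filter mem_iota subnKC; last by lia.
        by rewrite -[b n]negbK -(black_upper_row un) bu; lia.
      by rewrite subnKC //; lia.
    + by move=> _ ->; lia.
  case=> m; rewrite mem_filter mem_iota => /andP[bm /andP[_ mn]] um.
  have [_ du _] := upper_rowP um; split.
    by apply: upper_row_region um; lia.
  rewrite /middle_white_regular (black_upper_row um) bm andbT.
  rewrite /in_middle /regular /above /below du (upper_row_kind um).
  case: (boolP (drawn O _)) => dm /=.
    by rewrite /lvl /ell' /top_diag; lia.
  have : lvl (nupper O + m).+1 != ell' O by apply: contraNneq dm => ->.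
  by rewrite /lvl /ell' /top_diag; lia.
move=> E1 E2; rewrite /middle_height E1 E2; split=> //.
by apply: eq_bigr => m _; rewrite size_upper_row.
Qed.

(** Here regular triangles point down, so the rows counted are lower rows, starting with the
    triangles hanging from [ell']. *)
Lemma lower_part_rows :
  lower_height O black = (\sum_(m < nlower O) b (nupper O + nmiddle O + m))%N /\
  num_cells O black (lower_black_regular O black) =
    (\sum_(m < nlower O | b (nupper O + nmiddle O + m)) W (nupper O + nmiddle O + m))%N.
Proof.
have NE : N = (nupper O + nmiddle O + nlower O)%N by [].
set k := (nupper O + nmiddle O)%N in NE *.
have := @count_rows [seq m <- iota 0 (nlower O) | b (k + m)]
  (fun m => lower_row (k + m)) (addn k) (lower_black_regular O black).
rewrite (count_iota (fun m => b (k + m))) (sum_iota (fun m => b (k + m))) => -[].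
- by rewrite filter_uniq ?iota_uniq.
- move=> m; rewrite mem_filter mem_iota => /andP[_ /andP[_ mn]].
  by rewrite size_lower_row row_width_gt0 //; lia.
- by move=> m; apply: uniq_lower_row.
- exact: addnI.
- by move=> n u v; apply: row_label_lower.
- by move=> n u /lower_rowP[].
- move=> u; apply/andP/hasP.
    case=> /region_kind[n [du nu]].
    rewrite /lower_black_regular /in_lower /regular /above /below => /and3P[].
    move: nu du; rewrite /lvl /ell' /top_diag; case: u.1 => /=.
    + case=> _ un nN -> ab _ bu; exists (n - k)%N.
        rewrite mem_filter mem_iota subnKC; last by lia.
        by have [_ _ <-] := lower_rowP un; rewrite bu; lia.
      by rewrite subnKC //; lia.
    + by move=> _ ->; lia.
    + case=> un nN -> ab _ bu; exists (n - k)%N.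
        rewrite mem_filter mem_iota subnKC; last by lia.
        by have [_ _ <-] := lower_rowP un; rewrite bu; lia.
      by rewrite subnKC //; lia.
  case=> m; rewrite mem_filter mem_iota => /andP[bm /andP[_ mn]] um.
  have [_ du bu] := lower_rowP um; split.
    by apply: lower_row_region um; lia.
  rewrite /lower_black_regular bu bm andbT.
  rewrite /in_lower /regular /above /below du (lower_row_kind um).
  case: (boolP (drawn O _)) => dm /=.
    by rewrite /lvl /ell' /top_diag; lia.
  have : lvl (k + m) != ell' O by apply: contraNneq dm => ->.
  by rewrite /lvl /ell' /top_diag; lia.
move=> E1 E2; rewrite /lower_height E1 E2; split=> //.
by apply: eq_bigr => m _; rewrite size_lower_row.
Qed.

End Boundary.

(** * The distinguished and extreme diagonals, and assembly of the theorem *)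

Lemma drawn_ell (O : quasi_octagon) : drawn O (ell O).
Proof.
rewrite /drawn /drawn_diags !mem_cat; apply/orP; right; apply/orP; left.
by apply/mapP; exists 0%N; rewrite ?mem_iota //= take0 subr0.
Qed.

Lemma drawn_ell' (O : quasi_octagon) : drawn O (ell' O).
Proof.
rewrite /drawn /drawn_diags !mem_cat; apply/orP; right; apply/orP; left.
by apply/mapP; exists (size (middle_dist O)); rewrite ?mem_iota ?take_size //= add0n ltnSn.
Qed.

Lemma drawn_top (O : quasi_octagon) : upper_dist O <> [::] -> drawn O (top_diag O).
Proof.
move=> d0; rewrite /drawn /drawn_diags !mem_cat; apply/orP; left.
apply/mapP; exists 0%N; last by rewrite drop0.
by rewrite mem_iota; case: (upper_dist O) d0.
Qed.

Lemma drawn_bottom (O : quasi_octagon) :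
  lower_dist O <> [::] -> drawn O (bottom_diag O).
Proof.
move=> d0; rewrite /drawn /drawn_diags !mem_cat; apply/orP; right; apply/orP; right.
apply/mapP; exists 0%N; last by rewrite drop0.
by rewrite mem_iota; case: (lower_dist O) d0.
Qed.

Theorem theorem1p1 (a : nat) (d dbar d' : seq nat) (c0 x0 : int)
    (black : cell -> bool) (h1 h2 h3 w : nat) :
  let O := QuasiOctagon a d dbar d' c0 x0 in
  let C1 := num_cells O black (upper_black_regular O black) in
  let C2 := num_cells O black (middle_white_regular O black) in
  let C3 := num_cells O black (lower_black_regular O black) in
  (0 < a)%N ->
  d <> [::] -> dbar <> [::] -> d' <> [::] ->
  (forall x : nat, x \in d -> (0 < x)%N) ->
  (forall x : nat, x \in dbar -> (0 < x)%N) ->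
  (forall x : nat, x \in d' -> (0 < x)%N) ->
  is_coloring O black ->
  boundaries_disjoint O black ->
  bottom_white O black ->
  upper_height O black = h1 ->
  middle_height O black = h2 ->
  lower_height O black = h3 ->
  upper_width O black = w ->
  lower_width O black = w ->
  (h1 < w)%N -> (h2 < w)%N -> (h3 < w)%N ->
  ((h1 + h3)%N <> (w + h2)%N -> tilings O black = set0)
  /\
  ((h1 + h3)%N = (w + h2)%N ->
    #|tilings O black|%:R =
      (2 : rat) ^ ((C1 + C2 + C3)%:Z
                   - ((h1 * (2 * w - h1 + 1)) %/ 2)%:Z
                   - ((h2 * (2 * w - h2 + 1)) %/ 2)%:Z
                   - ((h3 * (2 * w - h3 + 1)) %/ 2)%:Z)
      * (2 : rat) ^ ('C(h1 + 2 * h2 + h3, 2)%:Z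
                     - (2 * h2 * (w + h2))%:Z
                     - 'C(h1 + h2, 2)%:Z
                     - 'C(h2 + h3, 2)%:Z)
      * (((\prod_((h2 + h3).+1 <= i < (h2 + w).+1) (i.-1)`!)
          * (\prod_((h1 + h2).+1 <= i < (h2 + w).+1) (i.-1)`!)
          * (\prod_(1 <= i < (w - h3).+1) (i.-1)`!)
          * (\prod_(1 <= i < (w - h1).+1) (i.-1)`!))%N%:R
         / (\prod_(1 <= i < (w - h2).+1) ((h2 + i).-1`! * (w - i)`!))%N%:R)).
Proof.
move=> O C1 C2 C3 a0 d0 _ d'0 dpos _ _ col disj bw.
have dtop : drawn O (top_diag O) by apply: drawn_top.
have dbot : drawn O (bottom_diag O) by apply: drawn_bottom.
have nu0 : (0 < nupper O)%N.
  rewrite /nupper /=; case: (d) d0 dpos => // x s _ pos /=.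
  by rewrite addn_gt0 pos // inE eqxx.
have N0 : (0 < nsteps O)%N by rewrite /nsteps -addnA addn_gt0 nu0.
have top_white : ~~ lower_black_at O black 0.
  have := col.2 (0, top_diag O); rewrite /lower_black_at lvl0 /lower_black /se_cell.
  have -> : level (0, top_diag O) = top_diag O by rewrite /level subr0.
  by rewrite dtop => ->.
(* The triangles on the bottom diagonal are white, so the row just above them is black; one such
   triangle exists because the width is positive. *)
have bottom n : n.+1 = nsteps O -> lower_black_at O black n.
  move=> nN; have N1 : (n.+1 <= nsteps O)%N by rewrite nN.
  have un : nw_cell O (pt O black n.+1 0) \in upper_row O black n.+1.
    by apply: map_f; rewrite mem_iota (row_width_gt0 col a0 disj N1).
  have [_ du _] := upper_rowP col a0 un.
  have := bw (nw_cell O (pt O black n.+1 0)).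
  rewrite (black_upper_row col a0 un) negbK; apply.
    by apply: (upper_row_region col a0 dtop dbot) un; rewrite /= nN.
  by rewrite du nN lvlN.
have [hE1 cE1] := upper_part_rows col a0 disj dtop dbot N0 top_white
  (drawn_ell O) (drawn_ell' O).
have [hE2 cE2] := middle_part_rows col a0 disj dtop dbot N0 top_white
  (drawn_ell O) (drawn_ell' O).
have [hE3 cE3] := lower_part_rows col a0 disj dtop dbot N0 top_white
  (drawn_ell O) (drawn_ell' O).
rewrite hE1 hE2 hE3 => <- <- <- Ww Ww' h1w h2w h3w.
have := transfer_count (W := row_width O black) (b := lower_black_at O black)
  (T := completions O black) (n1 := nupper O) (n2 := nmiddle O)
  (n3 := nlower O) (w := w).
rewrite -(card_tilings col a0 dtop dbot N0 top_white) /C1 /C2 /C3 cE1 cE2 cE3.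
case=> //.
- move=> m mn; apply: outer_completions => //; rewrite /nsteps /in_middle_zone; lia.
- move=> m mn; apply: inner_completions => //; rewrite /nsteps /in_middle_zone; lia.
- move=> m mn; apply: outer_completions => //; rewrite /nsteps /in_middle_zone; lia.
- by move=> P _; rewrite completionsN.
move=> none count; split=> // ne; apply/eqP; rewrite -cards_eq0; apply/eqP.
exact: none.
Qed.
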